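(* Let $K\subset\mathbb R^2$ be an origin-symmetric convex body with boundary of class $C^2$, and let $\delta_*=\frac12\mathrm{Vol}_2(K)$. If $\Gamma_{\delta_*}(K)$ is homothetic to $\mathcal I^*K$, then $K$ is an ellipse.
   Context: A convex body is a compact convex set with non-empty interior. For each unit vector $\boldsymbol\xi$ let $H_{\boldsymbol\xi}$ be the line orthogonal to $\boldsymbol\xi$ such that the half-plane $H_{\boldsymbol\xi}^-$ cuts off from $K$ area exactly $\delta_*$ (for symmetric $K$ these are the lines through the origin); $\Gamma_{\delta_*}(K)$ is the locus of the centroids of $K\cap H_{\boldsymbol\xi}^-$. The intersection body $\mathcal IK$ of $K$ is the star body with radial function $\rho_{\mathcal IK}(\boldsymbol\xi)=\mathrm{Vol}_1(K\cap\boldsymbol\xi^\perp)$, and $\mathcal I^*K=(\mathcal IK)^*$ is its polar body, with support function $h_{\mathcal I^*K}=1/\rho_{\mathcal IK}$. Two curves/bodies are homothetic if one is the image of the other under a map $x\mapsto q+\lambda(x-q)$ with $\lambda>0$. *)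

(* Defs.v *)
From HB Require Import structures.
From mathcomp Require Import all_boot all_order all_algebra.
From mathcomp Require Import all_classical all_reals all_analysis.
Import Order.TTheory GRing.Theory Num.Theory.
Import numFieldNormedType.Exports.
Set Implicit Arguments. Unset Strict Implicit. Unset Printing Implicit Defensive.
Local Open Scope classical_set_scope.
Local Open Scope ring_scope.

Definition dot {R : realType} (x y : R * R) : R := x.1 * y.1 + x.2 * y.2.

Definition unitv {R : realType} (u : R * R) : Prop := dot u u = 1.

Definition perp {R : realType} (u : R * R) : R * R := (- u.2, u.1).

Definition area {R : realType} (A : set (R * R)) : \bar R :=
  ((@lebesgue_measure R) \x (@lebesgue_measure R))%E A.

Definition convex_set2 {R : realType} (K : set (R * R)) : Prop :=
  forall x y t, K x -> K y -> 0 <= t <= 1 ->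
    K (t * x.1 + (1 - t) * y.1, t * x.2 + (1 - t) * y.2).

Definition convex_body {R : realType} (K : set (R * R)) : Prop :=
  compact K /\ convex_set2 K /\ (interior K !=set0).

Definition origin_symmetric {R : realType} (K : set (R * R)) : Prop :=
  forall x, K x -> K (- x.1, - x.2).

Definition bd {R : realType} (A : set (R * R)) : set (R * R) :=
  closure A `\` interior A.

(* boundary of class C^2: near each boundary point p, after a rotation
   (given by a unit vector u), K is the subgraph {x | x.u <= f(x.u^perp)}
   of a C^2 function f : R -> R. *)
Definition C2_function {R : realType} (f : R -> R) : Prop :=
  (forall s, derivable f s 1) /\ (forall s, derivable (derive1 f) s 1) /\
  continuous (derive1 (derive1 f)).

Definition C2_boundary {R : realType} (K : set (R * R)) : Prop :=
  forall p, bd K p ->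
    exists (u : R * R) (r : R) (f : R -> R),
      [/\ unitv u, 0 < r, C2_function f &
        K `&` ball p r = [set x | ball p r x /\ dot x u <= f (dot x (perp u))]].

Definition centroid {R : realType} (A : set (R * R)) : R * R :=
  let mu := ((@lebesgue_measure R) \x (@lebesgue_measure R))%E in
  (fine (\int[mu]_(x in A) (x.1)%:E)%E / fine (area A),
   fine (\int[mu]_(x in A) (x.2)%:E)%E / fine (area A)).

Definition delta_star {R : realType} (K : set (R * R)) : R := fine (area K) / 2.

Definition Gamma {R : realType} (delta : R) (K : set (R * R)) : set (R * R) :=
  [set c | exists (xi : R * R) (t : R),
     [/\ unitv xi, area (K `&` [set x | dot x xi <= t]) = delta%:E &
         c = centroid (K `&` [set x | dot x xi <= t])]].

(* radial function of the intersection body: length of the chord K cap xi^perp *)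
Definition rho_I {R : realType} (K : set (R * R)) (xi : R * R) : R :=
  fine (@lebesgue_measure R [set s : R | K (s * (perp xi).1, s * (perp xi).2)]).

Definition intersection_body {R : realType} (K : set (R * R)) : set (R * R) :=
  [set x | exists (r : R) (xi : R * R),
     [/\ unitv xi, 0 <= r <= rho_I K xi & x = (r * xi.1, r * xi.2)]].

Definition polar {R : realType} (L : set (R * R)) : set (R * R) :=
  [set y | forall x, L x -> dot x y <= 1].

Definition Istar {R : realType} (K : set (R * R)) : set (R * R) :=
  polar (intersection_body K).

Definition homothetic {R : realType} (A B : set (R * R)) : Prop :=
  exists (q : R * R) (lam : R), 0 < lam /\
    A = [set (q.1 + lam * (x.1 - q.1), q.2 + lam * (x.2 - q.2)) | x in B].

Definition is_ellipse {R : realType} (K : set (R * R)) : Prop :=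
  exists (c : R * R) (a b c' d : R), a * d - b * c' != 0 /\
    K = [set (c.1 + (a * x.1 + b * x.2), c.2 + (c' * x.1 + d * x.2)) |
          x in [set x : R * R | x.1 ^+ 2 + x.2 ^+ 2 <= 1]].

(* Main.v *)
Require Import Defs.
From HB Require Import structures.
From mathcomp Require Import all_boot all_order all_algebra.
From mathcomp Require Import all_classical all_reals all_analysis.
From mathcomp Require Import measurable_realfun ring lra.

(* Write [r w] for the radius of [K] in direction [w] ([rad]) and
   [M v] for the integral of [|x . v|] over [K] ([abs_moment]).  The support
   function of the curve of centroids is [M v / area K], because the centroid of
   the half of [K] on the positive side of [v] is extremal in direction [v] among
   all halves.  In the plane the intersection body is [2 K] turned by a right
   angle, so the support function of its polar at [v] is [1 / (2 r w)], where [v]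
   is [w] turned by a right angle.  Homothety (and symmetry, which disposes of
   the centre) thus says that [M v * r w] is constant.

   Restrict to [w = (1, s)].  Then [M] is a function of the slope [s], and its
   second difference with step [h] is an integral over a thin double wedge around
   the line of slope [s], which gives [M'' = (4 / 3) r ^ 3 = C / M ^ 3].  Along
   solutions of this equation [M' ^ 2 + C / M ^ 2] is constant and equal to
   [(M ^ 2)'' / 2], so [M ^ 2], hence [1 / r ^ 2], is a quadratic polynomial in
   [s]; that is, [K] is a sublevel set of a quadratic form.

   A priori the second derivative only exists in the symmetric (Schwarz) sense;
   since [C / M ^ 3] is continuous, subtracting a double antiderivative and
   applying Schwarz's theorem makes [M] twice differentiable. *)

Import Order.TTheory GRing.Theory Num.Theory.
Import numFieldNormedType.Exports.
Set Implicit Arguments. Unset Strict Implicit. Unset Printing Implicit Defensive.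
Local Open Scope classical_set_scope.
Local Open Scope ring_scope.

(** * Symmetric second derivatives and the equation [f'' = C / f ^ 3] *)

Definition sym_derive2 {R : realType} (f : R -> R) (s l : R) : Prop :=
  forall e : R, 0 < e -> exists2 d : R, 0 < d & forall h, 0 < h -> h < d ->
    `|f (s + h) + f (s - h) - 2 * f s - l * h ^+ 2| <= e * h ^+ 2.

Section symmetric_second_derivative.
Context {R : realType}.
Implicit Types (f g : R -> R) (s l : R).

Lemma sym_derive2B f g s l m : sym_derive2 f s l -> sym_derive2 g s m ->
  sym_derive2 (fun x => f x - g x) s (l - m).
Proof.
move=> fl gm e e0; have e20 : 0 < e / 2 by lra.
have [d1 d10 H1] := fl _ e20; have [d2 d20 H2] := gm _ e20.
exists (Num.min d1 d2); first by rewrite lt_min d10.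
move=> h h0; rewrite lt_min => /andP[hd1 hd2].
have := H1 h h0 hd1; have := H2 h h0 hd2; rewrite !ler_norml.
by move=> /andP[? ?] /andP[? ?]; apply/andP; split; lra.
Qed.

Lemma sym_derive2_affine a b s : sym_derive2 (fun x => a + b * x) s 0.
Proof.
move=> e e0; exists 1 => // h h0 _.
rewrite (_ : _ - _ = 0) ?normr0; last by ring.
by rewrite mulr_ge0 ?sqr_ge0// ltW.
Qed.

Lemma is_derive_eps f s l : is_derive s 1 f l -> forall e : R, 0 < e ->
  exists2 d : R, 0 < d & forall h, `|h| < d -> `|f (s + h) - f s - l * h| <= e * `|h|.
Proof.
move=> [df fl] e e0.
have /cvgrPdist_le/(_ _ e0) : h^-1 *: (f (h *: 1 + s) - f s) @[h --> 0^'] --> l.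
  by rewrite -fl; exact: df.
move=> -[d /= d0 H].
exists d => // h hd; have [->|h0] := eqVneq h 0.
  by rewrite addr0 subrr mulr0 subr0 normr0 mulr0.
have := H h; rewrite /ball_ /= sub0r normrN => /(_ hd h0).
rewrite -(ler_pM2r (_ : 0 < `|h|)) ?normr_gt0// -normrM -normrN.
suff -> : - ((l - h^-1 *: (f (h *: 1 + s) - f s)) * h) = f (s + h) - f s - l * h by [].
rewrite /GRing.scale /= mulr1 [h + s]addrC mulrBl mulrAC mulVf// mul1r.
by ring.
Qed.

Lemma is_derive1_near f g s l r : 0 < r ->
  (forall z, `|z - s| < r -> f z = g z) -> is_derive s 1 f l -> is_derive s 1 g l.
Proof.
move=> r0 fg; apply: near_eq_is_derive.
by exists r => //= z sz; apply: fg; rewrite distrC.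
Qed.

Lemma is_derive_affine (p q s : R) : is_derive s 1 (fun x => p + q * x) q.
Proof.
rewrite (_ : (fun x => _) = cst p + q \*: id)//.
have := is_deriveD (is_derive_cst p s 1) (is_deriveZ q (is_derive_id s 1)).
by rewrite /GRing.scale /= mulr1 add0r.
Qed.

(* Apply the mean value theorem to [h |-> f (s + h) + f (s - h) - l * h ^ 2]. *)
Lemma is_derive_sym_derive2 f f' s l :
  (exists2 r : R, 0 < r & forall x, `|x - s| < r -> is_derive x 1 f (f' x)) ->
  is_derive s 1 f' l -> sym_derive2 f s l.
Proof.
move=> [r r0 df] df' e e0; have e20 : 0 < e / 2 by lra.
have [d d0 H] := is_derive_eps df' e20.
exists (Num.min d r); first by rewrite lt_min d0.
move=> h h0; rewrite lt_min => /andP[hd hr].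
pose k := fun t : R => f (s + t) + f (s - t) - l * t ^+ 2.
have dk (t : R) : `|t| < r -> is_derive t 1 k (f' (s + t) - f' (s - t) - 2 * l * t).
  move=> tr.
  have d1 : is_derive (s + t) 1 f (f' (s + t)).
    by apply: df; rewrite addrAC subrr add0r.
  have d2 : is_derive (s - t) 1 f (f' (s - t)).
    by apply: df; rewrite addrAC subrr add0r normrN.
  have e1 : is_derive t 1 (fun x : R => s + x) 1.
    rewrite (_ : (fun x => _) = (fun x => s + 1 * x)); first exact: is_derive_affine.
    by apply/funext => x; rewrite mul1r.
  have e2 : is_derive t 1 (fun x : R => s - x) (- 1).
    rewrite (_ : (fun x => _) = (fun x => s + -1 * x)); first exact: is_derive_affine.
    by apply/funext => x; rewrite mulN1r.
  have c1 := @is_derive1_comp _ f (fun x : R => s + x) t _ _ d1 e1.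
  have c2 := @is_derive1_comp _ f (fun x : R => s - x) t _ _ d2 e2.
  rewrite (_ : k = (f \o (fun x => s + x)) + (f \o (fun x => s - x))
              - (l \*: (id ^+ 2)))//.
  by apply: is_derive_eq; rewrite /GRing.scale /=; ring.
have [c] : exists2 c, c \in `]0, h[ &
    k h - k 0 = (f' (s + c) - f' (s - c) - 2 * l * c) * (h - 0).
  apply: MVT => //.
    move=> x; rewrite in_itv/= => /andP[x0 xh].
    by apply: dk; rewrite gtr0_norm// (lt_trans xh).
  apply: derivable_within_continuous => x; rewrite in_itv/= => /andP[x0 xh].
  have [] // := dk x.
  by rewrite ger0_norm// (le_lt_trans xh).
rewrite in_itv/= subr0 => /andP[c0 ch] kE.
have -> : f (s + h) + f (s - h) - 2 * f s - l * h ^+ 2 = k h - k 0.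
  by rewrite /k addr0 subr0; ring.
rewrite kE normrM (gtr0_norm h0) expr2 mulrA ler_pM2r//.
(* The expansion of [f'] at [s], used at [c] and at [- c] with error [e / 2] each, bounds the
   derivative of [k] at [c] by [e * c]. *)
have cd : `|c| < d by rewrite gtr0_norm// (lt_trans ch).
have cd' : `|- c| < d by rewrite normrN.
have := H _ cd; have := H _ cd'; rewrite normrN (gtr0_norm c0) !ler_norml.
move=> /andP[A1 A2] /andP[B1 B2].
have : e * c <= e * h by rewrite ler_pM2l// ltW.
by move=> ?; apply/andP; split; lra.
Qed.

(* At an interior maximum of [f + eta (x - a) (x - b)] the second difference
   would be both nonpositive and at least [eta h ^ 2]. *)
Lemma sym_derive2_0_le0 f (a b : R) : a < b -> {within `[a, b], continuous f} ->
  f a = 0 -> f b = 0 -> (forall s, a < s < b -> sym_derive2 f s 0) ->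
  forall s, a <= s <= b -> f s <= 0.
Proof.
move=> ab cf fa fb sf s /andP[as_ sb]; rewrite leNgt; apply/negP => fs.
have {as_} as_ : a < s.
  by rewrite lt_neqAle as_ andbT; apply/eqP => E; move: fs; rewrite -E fa ltxx.
have {sb} sb : s < b.
  by rewrite lt_neqAle sb andbT; apply/eqP => E; move: fs; rewrite E fb ltxx.
(* This [eta] makes the correction at [s] equal to half of [f s], so [g] is still positive at [s]
   while it vanishes at [a] and [b]. *)
pose eta := f s / (2 * ((s - a) * (b - s))).
have p0 : 0 < (s - a) * (b - s) by rewrite mulr_gt0// subr_gt0.
have eta0 : 0 < eta by rewrite divr_gt0// mulr_gt0.
pose g := fun x => f x - eta * ((x - a) * (b - x)).
have gs : 0 < g s.
  rewrite /g (_ : eta * _ = f s / 2); first by lra.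
  by rewrite /eta; field; rewrite !subr_eq0 !gt_eqF.
have cg : {within `[a, b], continuous g}.
  move=> x; apply: cvgB; first exact: cf.
  apply: (@continuous_subspaceT _ _ `[a, b] (fun x => eta * ((x - a) * (b - x)))).
  move=> y; apply: cvgM; first exact: cvg_cst.
  apply: cvgM; apply: cvgB; [exact: cvg_id|exact: cvg_cst|exact: cvg_cst|exact: cvg_id].
have [c] := EVT_max (ltW ab) cg.
rewrite in_itv/= => /andP[ac cb] cmax.
have gc : 0 < g c.
  by apply: lt_le_trans gs _; apply: cmax; rewrite in_itv/= !ltW.
have {ac} ac : a < c.
  rewrite lt_neqAle ac andbT; apply/eqP => E; move: gc.
  by rewrite -E /g fa subrr mul0r mulr0 subr0 ltxx.
have {cb} cb : c < b.
  rewrite lt_neqAle cb andbT; apply/eqP => E; move: gc.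
  by rewrite E /g fb subrr mulr0 mulr0 subr0 ltxx.
have [d d0 H] : exists2 d : R, 0 < d & forall h, 0 < h -> h < d ->
    `|f (c + h) + f (c - h) - 2 * f c - 0 * h ^+ 2| <= eta * h ^+ 2.
  by apply: sf => //; rewrite ac.
pose m := Num.min d (Num.min (c - a) (b - c)).
have m0 : 0 < m by rewrite !lt_min d0 !subr_gt0 ac.
have [md mca mbc] : [/\ m <= d, m <= c - a & m <= b - c].
  by rewrite /m !ge_min !lexx ?orbT.
have h0 : 0 < m / 2 by lra.
have := H _ h0; rewrite ler_norml => /(_ ltac:(lra))/andP[Hl _].
have := cmax (c + m / 2); rewrite in_itv/= => /(_ ltac:(lra)).
have := cmax (c - m / 2); rewrite in_itv/= => /(_ ltac:(lra)).
have := mulr_gt0 eta0 (exprn_gt0 2 h0).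
rewrite /g; move: Hl; set h := m / 2; set F := f _; set G := f _.
by move=> *; nra.
Qed.

(** Schwarz's theorem: after subtracting the chord through the endpoints, the one-sided bound
    applies to the difference and to its negative. *)
Lemma sym_derive2_0_affine f (a b : R) : a < b ->
  {within `[a, b], continuous f} ->
  (forall s, a < s < b -> sym_derive2 f s 0) ->
  exists p q, forall s, a <= s <= b -> f s = p + q * s.
Proof.
move=> ab cf sf.
pose q := (f b - f a) / (b - a); pose p := f a - q * a.
have ba0 : b - a != 0 by rewrite subr_eq0 gt_eqF.
have qE : q * (b - a) = f b - f a by rewrite /q -mulrA mulVf ?mulr1.
have caff : {within `[a, b], continuous (fun x => p + q * x)}.
  apply: continuous_subspaceT => y; apply: cvgD; first exact: cvg_cst.
  by apply: cvgM; [exact: cvg_cst|exact: cvg_id].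
exists p, q => s sab; apply/eqP; rewrite eq_le -subr_le0 -[X in _ && X]subr_le0.
apply/andP; split.
- apply: (@sym_derive2_0_le0 (fun x => f x - (p + q * x)) a b) => //.
  + by move=> x; apply: cvgB; [exact: cf|exact: caff].
  + by rewrite /p; ring.
  + by rewrite /p; nra.
  + move=> t tab; rewrite -(subr0 0).
    by apply: sym_derive2B; [exact: sf|exact: sym_derive2_affine].
- apply: (@sym_derive2_0_le0 (fun x => (p + q * x) - f x) a b) => //.
  + by move=> x; apply: cvgB; [exact: caff|exact: cf].
  + by rewrite /p; ring.
  + by rewrite /p; nra.
  + move=> t tab; rewrite -(subr0 0).
    by apply: sym_derive2B; [exact: sym_derive2_affine|exact: sf].
Qed.

(** Continuity is asked only to the right of [a], so the construction can be iterated on an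
    antiderivative that is itself known only on a half-line. *)
Lemma continuous_antiderivative f (a : R) :
  (forall x, a < x -> {for x, continuous f}) -> forall c, a < c ->
  exists F, forall x, c < x -> is_derive x 1 F (f x).
Proof.
move=> cf c ac.
exists (fun x => \int[lebesgue_measure]_(t in `[c, x]) f t) => x cx.
have [||||dF FE] := @continuous_FTC1_closed _ f c x (x + 1).
- by rewrite ltrDl.
- apply: continuous_compact_integrable; first exact: segment_compact.
  apply/continuous_in_subspaceT => z; rewrite inE/= in_itv/= => /andP[cz _].
  by apply: cf; rewrite (lt_le_trans ac).
- exact: cx.
- by apply: cf; rewrite (lt_trans ac).
- by apply: DeriveDef; [exact: dF|rewrite -derive1E; exact: FE].
Qed.

Lemma sym_derive2_is_derive f phi : continuous f -> continuous phi ->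
  (forall s, sym_derive2 f s (phi s)) ->
  exists f', forall s, is_derive s 1 f (f' s) /\ is_derive s 1 f' (phi s).
Proof.
move=> cf cphi sf.
(* The witness is the global derivative, because its local expression [F1 t + q] depends on the
   point [s] around which it is built. *)
exists (fun s => 'D_1 f s) => s.
(* The base points [s - 2] and [s - 1] leave room: [F1] is continuous at and beyond the base point
   of [F2], and both are differentiable around [s]. *)
have [F1 dF1] : exists F, forall x, s - 2 < x -> is_derive x 1 F (phi x).
  by apply: (@continuous_antiderivative phi (s - 3)) => [x _|]; [exact: cphi|lra].
have cF1 x : s - 2 < x -> {for x, continuous F1}.
  move=> /dF1[+ _] => /derivable1_diffP; exact: differentiable_continuous.
have [F2 dF2] : exists F, forall x, s - 1 < x -> is_derive x 1 F (F1 x).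
  by apply: (@continuous_antiderivative F1 (s - 2)) => //; lra.
have [p [q pqE]] : exists p q, forall t, s - 2^-1 <= t <= s + 2^-1 ->
    f t - F2 t = p + q * t.
  apply: sym_derive2_0_affine; first by lra.
    apply/continuous_in_subspaceT => z; rewrite inE/= in_itv/= => /andP[z1 z2].
    apply: cvgB; first exact: cf.
    have /dF2[+ _] : s - 1 < z by lra.
    by move=> /derivable1_diffP; exact: differentiable_continuous.
  move=> t /andP[t1 t2]; rewrite -(subrr (phi t)); apply: sym_derive2B => //.
  apply: (@is_derive_sym_derive2 F2 F1); last by apply: dF1; lra.
  exists 2^-1; first by lra.
  by move=> x; rewrite ltr_norml => /andP[x1 x2]; apply: dF2; lra.
have df t : `|t - s| < 2^-1 -> is_derive t 1 f (F1 t + q).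
  rewrite ltr_norml => /andP[t1 t2].
  have d2 : is_derive t 1 F2 (F1 t) by apply: dF2; lra.
  have := is_deriveD d2 (is_derive_affine p q t).
  apply: (@is_derive1_near _ _ _ _ (2^-1 - `|t - s|)).
    by rewrite subr_gt0 ltr_norml; apply/andP; split; lra.
  move=> z tz.
  have zs : `|z - s| < 2^-1.
    rewrite (_ : z - s = (z - t) + (t - s)); last by ring.
    by apply: le_lt_trans (ler_normD _ _) _; rewrite -ltrBrDr.
  move: zs; rewrite ltr_norml => /andP[z1 z2].
  have : f z - F2 z = p + q * z by apply: pqE; lra.
  rewrite !fctE => ?; lra.
split.
  have h : is_derive s 1 f (F1 s + q) by apply: df; rewrite subrr normr0; lra.
  by apply: is_derive_eq; rewrite [RHS](@derive_val _ _ _ _ _ _ _ h).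
have d1 : is_derive s 1 F1 (phi s) by apply: dF1; lra.
have := is_deriveD d1 (is_derive_cst q s 1); rewrite addr0.
apply: (@is_derive1_near _ _ _ _ 2^-1); first by lra.
move=> z /df h; by rewrite [RHS](@derive_val _ _ _ _ _ _ _ h).
Qed.

(* The energy [f' ^ 2 + C / f ^ 2] is conserved, and [(f ^ 2)''] is twice it. *)
Lemma ermakov_square_quadratic f (C : R) : (forall s, 0 < f s) -> continuous f ->
  (forall s, sym_derive2 f s (C / f s ^+ 3)) ->
  exists p q r, forall s, f s ^+ 2 = p * s ^+ 2 + q * s + r.
Proof.
move=> f0 cf sf.
have cphi : continuous (fun s => C / f s ^+ 3).
  move=> s; apply: cvgM; first exact: cvg_cst.
  apply: cvgV; first by rewrite expf_neq0// gt_eqF.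
  by do 2! (apply: cvgM; first exact: cf); exact: cf.
have [f' df] := sym_derive2_is_derive cf cphi sf.
have fn0 s : f s != 0 by rewrite gt_eqF.
pose E s := f' s ^+ 2 + C * (f s)^-1 ^+ 2.
have EE s : E s = E 0.
  apply: is_derive_0_is_cst => t; have [d1 d2] := df t.
  have d3 := is_deriveV (fn0 t) d1.
  rewrite (_ : E = f' ^+ 2 + (C \*: ((fun y => (f y)^-1) ^+ 2)))//.
  apply: is_derive_eq; rewrite /GRing.scale /= expr1.
  by field.
(* The second derivative of [f ^ 2] is the constant [2 * p]. Two integrations follow: [k] is the
   derivative of [f ^ 2] minus [2 * p * s], and [m] is [f ^ 2] minus its quadratic and linear
   terms. *)
pose p := E 0.
pose k s := 2 * (f s * f' s) - 2 * p * s.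
have kE s : k s = k 0.
  apply: is_derive_0_is_cst => t; have [d1 d2] := df t.
  rewrite (_ : k = 2 \*: (f * f') - (2 * p) \*: id)//.
  apply: is_derive_eq; rewrite /GRing.scale /= /p -(EE t) /E.
  by field.
pose q := k 0.
pose m s := f s ^+ 2 - p * s ^+ 2 - q * s.
have mE s : m s = m 0.
  apply: is_derive_0_is_cst => t; have [d1 d2] := df t.
  rewrite (_ : m = f ^+ 2 - (p \*: (id ^+ 2)) - (q \*: id))//.
  apply: is_derive_eq; rewrite /GRing.scale /= /q -(kE t) /k expr1.
  by ring.
exists p, q, (m 0) => s; rewrite -(mE s) /m; ring.
Qed.

End symmetric_second_derivative.

(** * Lebesgue measure and explicit integrals in the plane *)

Definition opp2 {R : realType} (x : R * R) : R * R := (- x.1, - x.2).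

(* The second difference of [t |-> |t x1 - x2|] at [s] with step [h] is twice this
   function; it is supported on the double wedge of slopes within [h] of [s]. *)
Definition wedge_height {R : realType} (s h : R) (x : R * R) : R :=
  Num.max 0 (h * `|x.1| - `|s * x.1 - x.2|).

Lemma dot_self_gt0 {R : realType} (v : R * R) : v != 0 -> 0 < dot v v.
Proof.
move=> v0; rewrite /dot -!expr2 lt_neqAle addr_ge0 ?sqr_ge0// andbT eq_sym.
apply: contra v0; rewrite paddr_eq0 ?sqr_ge0// !sqrf_eq0 => /andP[/eqP v1 /eqP v2].
by rewrite (surjective_pairing v) v1 v2.
Qed.

Section plane_measure.
Context {R : realType}.
Notation mu := (@lebesgue_measure R).
Notation mu2 := (mu \x mu)%E.
(* [measurableTypeR R] and [R] carry the same measurable sets under different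
   displays; Lebesgue measure lives on the former. *)
Notation plane := (measurableTypeR R * measurableTypeR R)%type.

Lemma measurable_fst_plane : @measurable_fun _ _ plane R setT fst.
Proof. exact: measurable_fst. Qed.

Lemma measurable_snd_plane : @measurable_fun _ _ plane R setT snd.
Proof. exact: measurable_snd. Qed.

(** The product sigma-algebra is generated by rectangles, and an open set is the union of the
    countably many boxes inside it with rational centre and radius [1 / (n + 1)]. *)
Lemma open_measurable2 (U : set (R * R)) : open U -> measurable (U : set plane).
Proof.
move=> oU.
pose box (a b : rat) (n : nat) : set (R * R) :=
  ball (ratr a : R) n.+1%:R^-1 `*` ball (ratr b : R) n.+1%:R^-1.
have -> : U = \bigcup_a \bigcup_b \bigcup_n
    (if pselect (box a b n `<=` U) then box a b n else set0).
  apply/seteqP; split=> [x Ux|x [a _ [b _ [n _]]]]; last first.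
    by case: pselect => //= + bx; exact.
  have : nbhs x U by apply: open_nbhs_nbhs.
  rewrite -nbhs_ballE => -[e /= e0 eU].
  have [n ne] : exists n, n.+1%:R^-1 < e / 2.
    have := @near_infty_natSinv_lt R (PosNum (_ : 0 < e / 2)).
    by move=> /(_ ltac:(lra)) [n _ /(_ n (leqnn n))] /= ?; exists n.
  have rat_near (y : R) : exists a : rat, ball y n.+1%:R^-1 (ratr a).
    suff : ball y n.+1%:R^-1 `&` range ratr !=set0.
      by move=> [/= _ []] /[swap] -[a _ <-]; exists a.
    apply: dense_rat; last exact: ball_open.
    by exists y; apply: ballxx; rewrite invr_gt0 ltr0n.
  have [a xa] := rat_near x.1; have [b xb] := rat_near x.2.
  exists a => //; exists b => //; exists n => //.
  case: pselect => /= [_|]; first by split; exact: ball_sym.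
  have nne : n.+1%:R^-1 + n.+1%:R^-1 <= e.
    by rewrite -[leRHS](mulfVK (_ : 2 != 0))// mulr_natr mulr2n lerD// ltW.
  case=> y [ya yb]; apply: eU.
  split; first exact: (le_ball nne) (ball_triangle xa ya).
  exact: (le_ball nne) (ball_triangle xb yb).
apply: bigcupT_measurable_rat => a; apply: bigcupT_measurable_rat => b.
apply: bigcupT_measurable => n; case: pselect => _ //=.
by apply: (@measurableX _ _ (measurableTypeR R) (measurableTypeR R)); exact: measurable_ball.
Qed.

Lemma closed_measurable2 (A : set (R * R)) : closed A -> measurable (A : set plane).
Proof. by move=> /closed_openC/open_measurable2/measurableC; rewrite setCK. Qed.

Lemma measurable_dot (v : R * R) : @measurable_fun _ _ plane R setT (fun x => dot x v).
Proof.
apply: measurable_funD; apply: measurable_funM; try exact: measurable_cst.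
- exact: measurable_fst_plane.
- exact: measurable_snd_plane.
Qed.

Lemma measurable_opp2 : @measurable_fun _ _ plane plane setT (@opp2 R).
Proof.
have mopp : @measurable_fun _ _ (measurableTypeR R) (measurableTypeR R) setT -%R.
  by move=> _ A mA; exact: (@oppr_measurable R _ measurableT A mA).
apply: measurable_fun_pair; apply: measurableT_comp => //.
Qed.

Let push_opp2 : {measure set plane -> \bar R} :=
  measure_function_pushforward__canonical__measure_function_Measure mu2 measurable_opp2.

(** By uniqueness of the product measure it suffices to compare on rectangles, where invariance of
    one-dimensional Lebesgue measure under negation applies to each factor. *)
Lemma product_measure_opp2 (A : set plane) : measurable A ->
  mu2 (@opp2 R @^-1` A) = mu2 A.
Proof.
move=> mA; symmetry.
transitivity (push_opp2 A); last by [].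
apply: (@product_measure_unique _ _ _ _ _ mu mu push_opp2) => //.
move=> X Y mX mY; rewrite /push_opp2 /= /pushforward.
have -> : @opp2 R @^-1` (X `*` Y) = (-%R @^-1` X) `*` (-%R @^-1` Y) by [].
have mopp : measurable_fun setT (-%R : R -> R) by [].
have XE := lebesgue_measureN mX; have YE := lebesgue_measureN mY.
rewrite product_measure1E.
- by rewrite -XE -YE.
- by rewrite -[X in measurable X]setTI; exact: mopp.
- by rewrite -[X in measurable X]setTI; exact: mopp.
Qed.

Lemma ge0_integral_opp2 (D : set plane) (f : plane -> R) : measurable D ->
  measurable_fun setT f -> (forall x, 0 <= f x) ->
  (\int[mu2]_(x in @opp2 R @^-1` D) (f (opp2 x))%:E = \int[mu2]_(x in D) (f x)%:E)%E.
Proof.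
move=> mD mf f0.
have mfE : measurable_fun D (EFin \o f) by exact/measurable_EFinP/measurable_funTS.
have fE0 : {in D, forall y, 0 <= (EFin \o f) y}%E by move=> y _; rewrite lee_fin.
have pE := ge0_integral_pushforward measurable_opp2 mu2 mD mfE fE0.
transitivity (\int[push_opp2]_(y in D) (EFin \o f) y)%E.
  exact: esym pE.
apply: eq_measure_integral => A mA _.
exact: (product_measure_opp2 mA).
Qed.

(** If [v.2] is non-zero, the line meets each vertical in one point; otherwise it is the vertical
    axis, of measure [0 * +oo = 0]. *)
Lemma null_line (v : R * R) : v != 0 -> mu2 [set x | dot x v = 0] = 0%E.
Proof.
move=> v0; have [v20|v20] := eqVneq v.2 0; last first.
  rewrite /product_measure1 integral0_eq// => x _ /=.
  rewrite (_ : xsection _ _ = [set - (x * v.1) / v.2]) ?lebesgue_measure_set1//.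
  apply/seteqP; split => y; rewrite /xsection /= inE /= /dot /=.
    by move=> xy; apply: (mulIf v20); rewrite mulfVK//; lra.
  by move=> ->; rewrite mulfVK//; ring.
have v10 : v.1 != 0.
  by apply: contra v0 => /eqP v10; rewrite (surjective_pairing v) v10 v20.
have -> : [set x : R * R | dot x v = 0] = [set 0] `*` setT.
  apply/seteqP; split=> x /=; rewrite /dot v20 mulr0 addr0.
    by move=> /eqP; rewrite mulf_eq0 (negbTE v10) orbF => /eqP.
  by move=> [-> _]; rewrite mul0r.
rewrite product_measure1E; [|exact: measurable_set1|exact: measurableT].
transitivity (0 * mu setT)%E; last exact: mul0e.
by congr (_ * _)%E; exact: lebesgue_measure_set1.
Qed.

Lemma integral_itv_derive (f F : R -> R) (c d : R) : c <= d -> continuous f ->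
  (forall x : R, is_derive x 1 F (f x)) ->
  (\int[mu]_(x in `[c, d]) (f x)%:E = (F d - F c)%:E)%E.
Proof.
rewrite le_eqVlt => /predU1P[<-|cd] cf dF.
  by rewrite set_itv1 integral_set1 subrr.
have cF : continuous F.
  by move=> x; apply/differentiable_continuous/derivable1_diffP; have [] := dF x.
rewrite (@continuous_FTC2 _ f F) ?EFinB//.
- exact: continuous_subspaceT.
- split=> [x _||]; first by have [] := dF x.
  + exact/cvg_at_right_filter/cF.
  + exact/cvg_at_left_filter/cF.
- by move=> x _; rewrite derive1E; have [_ ->] := dF x.
Qed.

Lemma integral_itv_affine (p q c d : R) : c <= d ->
  (\int[mu]_(x in `[c, d]) (p + q * x)%R%:E =
    (p * (d - c) + q / 2 * (d ^+ 2 - c ^+ 2))%:E)%E.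
Proof.
move=> cd; have dF (x : R) : is_derive x 1 (fun x => p * x + q / 2 * x ^+ 2) (p + q * x).
  rewrite (_ : (fun x => _) = p \*: id + (q / 2) \*: (id ^+ 2))//.
  by apply: is_derive_eq; rewrite /GRing.scale /= expr1; field.
rewrite (integral_itv_derive cd _ dF); first by congr EFin; ring.
move=> y; apply: cvgD; first exact: cvg_cst.
by apply: cvgM; [exact: cvg_cst|exact: cvg_id].
Qed.

Lemma integral_sqr_itv (k a : R) : 0 <= a ->
  (\int[mu]_(x in `[(- a)%R, a]) (k * x ^+ 2)%R%:E = (2 / 3 * a ^+ 3 * k)%:E)%E.
Proof.
move=> a0; have aa : - a <= a by lra.
have dF (x : R) : is_derive x 1 (fun x => k / 3 * x ^+ 3) (k * x ^+ 2).
  rewrite (_ : (fun x => _) = (k / 3) \*: (id ^+ 3))//.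
  by apply: is_derive_eq; rewrite /GRing.scale /=; field.
rewrite (integral_itv_derive aa _ dF); first by congr EFin; field.
move=> y; apply: cvgM; first exact: cvg_cst.
by apply: cvgM; exact: cvg_id.
Qed.

(** The area of a triangle of base [2 * a] and height [a]: the integrand vanishes outside
    [[b - a, b + a]] and is affine on each half. *)
Lemma integral_tent (a b : R) : 0 <= a ->
  (\int[mu]_y (Num.max 0 (a - `|b - y|))%R%:E = (a ^+ 2)%:E)%E.
Proof.
move=> a0.
pose g y : R := Num.max 0 (a - `|b - y|).
have mg : measurable_fun [set: R] g.
  apply: measurable_maxr; first exact: measurable_cst.
  apply: measurable_funB; first exact: measurable_cst.
  apply: measurableT_comp; first exact: normr_measurable.
  by apply: measurable_funB; [exact: measurable_cst|exact: measurable_id].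
have gE y : `|b - y| <= a -> g y = a - `|b - y|.
  by move=> ?; rewrite /g; apply/max_idPr; rewrite subr_ge0.
rewrite (_ : [set: _] = (`]-oo, (b - a)%R[ `|` `[(b - a)%R, b]) `|`
    (`]b, (b + a)%R] `|` `](b + a)%R, +oo[)); last first.
  apply/seteqP; split=> y //= _; rewrite !in_itv/= !andbT.
  case: (ltP y (b - a)) => [?|y1]; [by left; left|].
  case: (leP y b) => [?|y2]; [by left; right|].
  by case: (leP y (b + a)) => [?|y3]; [right; left|right; right].
have mgE D : measurable_fun D (fun y : R => (g y)%:E).
  by apply/measurable_EFinP; apply: measurable_funTS.
rewrite !ge0_integral_setU//=; try by [exact: measurableU|exact: mgE|
  move=> *; rewrite lee_fin le_max lexx|].
- rewrite (_ : (\int[mu]_(x in `]-oo, (b - a)%R[) _)%E = 0%E); last first.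
    apply: integral0_eq => y /=; rewrite in_itv/= => yba.
    congr EFin; apply/max_idPl; rewrite subr_le0.
    by apply: le_trans (ler_norm _); lra.
  rewrite (_ : (\int[mu]_(x in `](b + a)%R, +oo[) _)%E = 0%E); last first.
    apply: integral0_eq => y /=; rewrite in_itv/= andbT => yba.
    congr EFin; apply/max_idPl; rewrite subr_le0 distrC.
    by apply: le_trans (ler_norm _); lra.
  rewrite add0e adde0 integral_itv_obnd_cbnd; last exact: mgE.
  rewrite (eq_integral (fun y : measurableTypeR R => ((a - b) + 1 * (y : R))%R%:E)); last first.
    move=> y; rewrite inE/= in_itv/= => /andP[y1 y2].
    have E : `|b - y| = b - y by rewrite ger0_norm// subr_ge0.
    by rewrite -/(g y) gE E; [congr EFin; ring|lra].
  rewrite [X in (_ + X)%E](eq_integral (fun y : measurableTypeR R => ((a + b) + -1 * (y : R))%R%:E)); last first.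
    move=> y; rewrite inE/= in_itv/= => /andP[y1 y2].
    have E : `|b - y| = y - b by rewrite distrC ger0_norm// subr_ge0.
    by rewrite -/(g y) gE E; [congr EFin; ring|lra].
  rewrite !integral_itv_affine; [|lra|lra].
  by rewrite -EFinD; congr EFin; field.
- by apply/disj_setPS => y [] /=; rewrite !in_itv/= ?andbT;
    (move=> [] H1 [] H2 || move=> H1 H2); lra.
- by apply/disj_setPS => y [] /=; rewrite !in_itv/= ?andbT;
    (move=> [] H1 [] H2 || move=> H1 H2); lra.
- by apply/disj_setPS => y [] /=; rewrite !in_itv/= ?andbT;
    (move=> [] H1 [] H2 || move=> H1 H2); lra.
Qed.

Lemma measurable_wedge_height (s h : R) :
  @measurable_fun _ _ plane R setT (wedge_height s h).
Proof.
apply: measurable_maxr; first exact: measurable_cst.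
apply: measurable_funB.
  apply: measurable_funM; first exact: measurable_cst.
  by apply: measurableT_comp; [exact: normr_measurable|exact: measurable_fst_plane].
apply: measurableT_comp; first exact: normr_measurable.
apply: measurable_funB; last exact: measurable_snd_plane.
by apply: measurable_funM; [exact: measurable_cst|exact: measurable_fst_plane].
Qed.

Lemma measurable_strip (a : R) :
  measurable ([set x : R * R | `|x.1| <= a] : set plane).
Proof.
rewrite (_ : [set x | _] = `[(- a)%R, a]%classic `*` setT).
  by apply: (@measurableX _ _ (measurableTypeR R) (measurableTypeR R)).
by apply/seteqP; split=> x /=; rewrite in_itv/= ler_norml => // -[].
Qed.

(** On the vertical section at [x.1] the integrand is a tent of height [h * |x.1|], which
    contributes [h ^ 2 * x.1 ^ 2]. The strip is the model for a body whose radius [rad K (1, m)]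
    equals [a] for every slope [m] in the wedge. *)
Lemma integral_wedge_height (s h a : R) : 0 <= h -> 0 <= a ->
  (\int[mu2]_(x in [set x : R * R | (`|x.1| <= a)%R]) (wedge_height s h x)%:E =
    (2 / 3 * a ^+ 3 * h ^+ 2)%:E)%E.
Proof.
move=> h0 a0.
set D := [set x : R * R | `|x.1| <= a]; set g := wedge_height s h.
have mg : @measurable_fun _ _ plane R setT g := measurable_wedge_height s h.
have mD : measurable (D : set plane) := measurable_strip a.
have mgE : @measurable_fun _ _ plane _ setT (EFin \o g) by exact/measurable_EFinP.
have mgD : @measurable_fun _ _ plane _ setT ((EFin \o g) \_ D).
  by apply/(measurable_restrictT _ mD); exact: measurable_funTS.
rewrite integral_mkcond fubini_tonelli1; last 2 first.
- exact: mgD.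
- by move=> x; rewrite patchE; case: ifP => // _; rewrite lee_fin le_max lexx.
transitivity (\int[mu]_x ((fun x : R => (h ^+ 2 * x ^+ 2)%R%:E) \_ `[(- a)%R, a]) x)%E.
  apply: eq_integral => x _; rewrite /fubini_F [RHS]patchE; case: ifPn => xa.
    move: xa; rewrite inE/= in_itv/= -ler_norml => xa.
    transitivity (\int[mu]_y (Num.max 0 (h * `|x : R| - `|s * x - y|))%R%:E)%E.
      by apply: eq_integral => y _; rewrite patchE mem_set.
    rewrite integral_tent; last by rewrite mulr_ge0.
    by rewrite exprMn real_normK// num_real.
  apply: integral0_eq => y _; rewrite patchE memNset//= => xa'.
  by move/negP: xa; apply; rewrite inE/= in_itv/= -ler_norml.
by rewrite -integral_mkcond integral_sqr_itv.
Qed.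

End plane_measure.

(** * The radius of a symmetric body and the polar of its intersection body *)

Definition rad {R : realType} (K : set (R * R)) (w : R * R) : R :=
  sup [set s | K (s * w.1, s * w.2)].

Section symmetric_body.
Context {R : realType} (K : set (R * R)).
Hypothesis Kbody : convex_body K.
Hypothesis Ksym : origin_symmetric K.

Lemma body_closed : closed K.
Proof.
apply: compact_closed; last by case: Kbody.
exact: norm_hausdorff.
Qed.

(** For [p] interior, [x] is the midpoint of [p + x] and of the reflection of [p - x]. *)
Lemma body_contains_box : exists2 e : R, 0 < e &
  forall x, `|x.1| < e -> `|x.2| < e -> K x.
Proof.
have [_ [Kconv [p]]] := Kbody.
rewrite /interior -nbhs_ballE => -[e /= e0 eK].
exists e => // -[x1 x2] /= x1e x2e.
have Kp : K (p.1 + x1, p.2 + x2).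
  by apply: eK; split; rewrite /ball/= /ball_ opprD addrA subrr sub0r normrN.
have Kn : K (p.1 - x1, p.2 - x2).
  by apply: eK; split; rewrite /ball/= /ball_ opprB addrC subrK.
have /= := Kconv _ _ 2^-1 Kp (Ksym Kn).
rewrite (_ : 2^-1 * (p.1 + x1) + (1 - 2^-1) * - (p.1 - x1) = x1); last by field.
rewrite (_ : 2^-1 * (p.2 + x2) + (1 - 2^-1) * - (p.2 - x2) = x2); last by field.
by apply; lra.
Qed.

Lemma body_bounded : exists2 M : R, 0 < M &
  forall x, K x -> `|x.1| <= M /\ `|x.2| <= M.
Proof.
have [Kc _] := Kbody.
have [M [_ H]] := compact_bounded Kc.
exists (`|M| + 1); first by rewrite ltr_pwDr.
move=> x /(H (`|M| + 1)); rewrite (le_lt_trans (ler_norm M)) ?ltrDl// => /(_ isT).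
by rewrite /= prod_normE ge_max => /andP[].
Qed.

Lemma body_scale x t : K x -> `|t| <= 1 -> K (t * x.1, t * x.2).
Proof.
have [_ [Kconv _]] := Kbody.
move=> Kx; rewrite ler_norml => /andP[t1 t2].
have /= := Kconv _ _ ((1 + t) / 2) Kx (Ksym Kx).
rewrite (_ : _ * x.1 + _ = t * x.1); last by field.
rewrite (_ : _ * x.2 + _ = t * x.2); last by field.
by apply; lra.
Qed.

(** Closedness of [K] makes the supremum attained, and symmetry with convexity fills the whole
    segment. The vector [w] need not be a unit vector, so that directions [(1, m)] can be used
    unnormalised; [rad K (1, m)] is then a bound on the first coordinate. *)
Lemma radP w : w != 0 -> 0 < rad K w /\
  forall s, K (s * w.1, s * w.2) <-> `|s| <= rad K w.
Proof.
move=> w0; pose S := [set s | K (s * w.1, s * w.2)].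
have [e e0 eK] := body_contains_box; have [M M0 KM] := body_bounded.
pose n := `|w.1| + `|w.2|.
have n0 : 0 < n.
  rewrite lt_neqAle addr_ge0// andbT eq_sym; apply: contra w0.
  rewrite paddr_eq0// !normr_eq0 => /andP[/eqP w1 /eqP w2].
  by rewrite (surjective_pairing w) w1 w2.
have wn1 : `|w.1| <= n by rewrite lerDl.
have wn2 : `|w.2| <= n by rewrite lerDr.
pose s0 := e / (2 * n).
have s00 : 0 < s0 by rewrite divr_gt0// mulr_gt0.
have s0n : s0 * n = e / 2 by rewrite /s0; field; rewrite gt_eqF.
have Ss0 : S s0.
  by apply: eK => /=; rewrite normrM (gtr0_norm s00);
    (apply: (@le_lt_trans _ _ (s0 * n)); [by rewrite ler_pM2l|lra]).
have Sub : has_ubound S.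
  exists (2 * M / n) => s /KM/= []; rewrite !normrM => H1 H2.
  rewrite ler_pdivlMr//; apply: le_trans (ler_norm _) _.
  by rewrite normrM (gtr0_norm n0) /n mulrDr; lra.
have rad0 : 0 < rad K w by apply: lt_le_trans s00 _; exact: ub_le_sup.
split=> // s; split=> [Ks|sr].
  rewrite ler_norml; apply/andP; split; last exact: ub_le_sup.
  rewrite lerNl; apply: ub_le_sup => //.
  by rewrite /S/= !mulNr; exact: Ksym Ks.
have Srad : K (rad K w * w.1, rad K w * w.2).
  have cl : closed S.
    apply: (@closed_comp _ _ (fun s : R => (s * w.1, s * w.2)) K); last exact: body_closed.
    move=> x _; exact: (cvg_pair (cvgM cvg_id (cvg_cst _)) (cvgM cvg_id (cvg_cst _))).
  by apply: cl; apply: closure_sup => //; exists s0.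
have /= := body_scale (t := s / rad K w) Srad.
rewrite !mulrA !mulfVK ?gt_eqF//; apply.
by rewrite normrM normfV (gtr0_norm rad0) ler_pdivrMr// mul1r.
Qed.

Lemma rad_opp w : rad K (opp2 w) = rad K w.
Proof.
congr sup; apply/seteqP; split=> s /=; rewrite !mulrN => /Ksym/=;
  by rewrite ?opprK.
Qed.

Lemma perp_neq0 (xi : R * R) : unitv xi -> perp xi != 0.
Proof.
move=> u; apply/eqP => -[/eqP]; rewrite oppr_eq0 => /eqP x2 x1.
by move: u; rewrite /unitv /dot x1 x2 !mulr0 addr0 => /eqP; rewrite eq_sym oner_eq0.
Qed.

Lemma rho_IE xi : unitv xi -> rho_I K xi = 2 * rad K (perp xi).
Proof.
move=> /perp_neq0/radP[r0 rE]; rewrite /rho_I.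
have -> : [set s | K (s * (perp xi).1, s * (perp xi).2)] =
    `[- rad K (perp xi), rad K (perp xi)]%classic.
  by apply/seteqP; split=> s /=; rewrite in_itv/= -ler_norml => /rE.
by rewrite lebesgue_measure_itv/= lte_fin ifT; [rewrite -EFinB/=; ring|lra].
Qed.

(** The map sending [x] to [(2 * x.2, - 2 * x.1)] carries [K] onto the intersection body, so
    polarity can be tested on points of [K] itself. *)
Lemma IstarP y : Istar K y <-> forall x, K x -> 2 * (x.2 * y.1 - x.1 * y.2) <= 1.
Proof.
split=> [Iy x Kx|H x [r [xi [uxi /andP[r0 rr] ->]]]]; last first.
  move: rr; rewrite rho_IE// => rr.
  have [_ rE] := radP (perp_neq0 uxi).
  have : K (r / 2 * (perp xi).1, r / 2 * (perp xi).2).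
    by apply/rE; rewrite ger0_norm; lra.
  by move=> /H/=; rewrite /dot/=; apply: le_trans; rewrite le_eqVlt; apply/orP; left;
    apply/eqP; field.
have [->/=|x0] := eqVneq x 0; first by rewrite !mul0r subrr mulr0 ler01.
pose n2 := dot x x; pose n := Num.sqrt n2.
have n20 : 0 < n2 := dot_self_gt0 x0.
have n0 : 0 < n by rewrite sqrtr_gt0.
have nn : n * n = n2 by rewrite -expr2 sqr_sqrtr// ltW.
(* Chosen so that [perp xi] is [x] normalised. *)
pose xi := (x.2 / n, - (x.1 / n)).
have uxi : unitv xi.
  rewrite /unitv /dot /xi /=.
  rewrite (_ : _ + _ = n2 / (n * n)); first by rewrite nn divff// gt_eqF.
  by rewrite /n2 /dot; field; rewrite gt_eqF.
have [_ rE] := radP (perp_neq0 uxi).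
have nr : `|n| <= rad K (perp xi).
  apply/rE; rewrite /perp/xi/= opprK.
  rewrite (_ : n * (x.1 / n) = x.1); last by field; rewrite gt_eqF.
  by rewrite (_ : n * (x.2 / n) = x.2) -?surjective_pairing//; field; rewrite gt_eqF.
have := Iy (2 * n * xi.1, 2 * n * xi.2).
rewrite (_ : dot _ y = 2 * (x.2 * y.1 - x.1 * y.2)); last first.
  by rewrite /dot /xi /=; field; rewrite gt_eqF.
apply; exists (2 * n), xi; split=> //; rewrite rho_IE//.
by move: nr; rewrite gtr0_norm// => nr; apply/andP; split; lra.
Qed.

(* In the coordinates [x = a p + b perp p], the slope of a supporting line at [p]
   is the supremum of the slopes seen from [p] on the side [b < 0]. *)
Lemma body_supporting_line p : p != 0 -> K p ->
  (forall a, K (a * p.1, a * p.2) -> a <= 1) ->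
  exists2 y, dot p y = 1 & forall x, K x -> dot x y <= 1.
Proof.
move=> p0 Kp p1; have [_ [Kconv _]] := Kbody.
pose n := dot p p.
have n0 : 0 < n := dot_self_gt0 p0.
have nn0 : n != 0 by rewrite gt_eqF.
pose al x := dot x p / n; pose be x := dot x (perp p) / n.
have decomp u : u = (al u * p.1 - be u * p.2, al u * p.2 + be u * p.1).
  rewrite [LHS]surjective_pairing; congr pair;
    by rewrite /al /be /n /dot /perp /=; field; exact: nn0.
have sepab x z : K x -> K z -> be x < 0 -> 0 < be z ->
    (al x - 1) * be z <= (al z - 1) * be x.
  move=> Kx Kz bx bz.
  have d0 : 0 < be z - be x by lra.
  have dn0 : be z - be x != 0 by rewrite gt_eqF.
  (* With this weight the combination of [x] and [z] has no component along [perp p]; it is a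
     multiple [a] of [p] lying in [K], whence [a <= 1]. *)
  pose t := be z / (be z - be x).
  have t01 : 0 <= t <= 1.
    by apply/andP; split; [rewrite divr_ge0 ?ltW|rewrite ler_pdivrMr//; lra].
  have := Kconv _ _ t Kx Kz t01.
  pose a := t * al x + (1 - t) * al z.
  have tb : t * be x + (1 - t) * be z = 0 by rewrite /t; field.
  rewrite (_ : t * x.1 + (1 - t) * z.1 = a * p.1); last first.
    rewrite {1}(decomp x) {1}(decomp z) /=.
    rewrite (_ : _ + _ = a * p.1 - (t * be x + (1 - t) * be z) * p.2); last by rewrite /a; ring.
    by rewrite tb mul0r subr0.
  rewrite (_ : t * x.2 + (1 - t) * z.2 = a * p.2); last first.
    rewrite {1}(decomp x) {1}(decomp z) /=.
    rewrite (_ : _ + _ = a * p.2 + (t * be x + (1 - t) * be z) * p.1); last by rewrite /a; ring.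
    by rewrite tb mul0r addr0.
  move=> /p1; rewrite -(ler_pM2r d0) mul1r.
  rewrite (_ : a * _ = be z * al x - be x * al z); last by rewrite /a /t; field.
  lra.
pose S := [set (al x - 1) / - be x | x in [set x | K x /\ be x < 0]].
(* The point [u] bounds the slopes in [S] from above, and its reflection shows that [S] is
   non-empty. *)
have [u Ku bu] : exists2 u, K u & 0 < be u.
  have [e e0 eK] := body_contains_box.
  pose m := `|p.1| + `|p.2| + 1.
  have m0 : 0 < m by rewrite ltr_wpDl// addr_ge0.
  pose d := e / (2 * m).
  have d0 : 0 < d by rewrite divr_gt0// mulr_gt0.
  have dm : d * m = e / 2 by rewrite /d; field; rewrite gt_eqF.
  exists (d * - p.2, d * p.1).
    apply: eK => /=; rewrite normrM ?normrN (gtr0_norm d0);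
      (apply: (@le_lt_trans _ _ (d * m)); [rewrite ler_pM2l//|lra]).
      by rewrite /m addrAC lerDr addr_ge0.
    by rewrite /m -addrA lerDl addr_ge0.
  rewrite /be (_ : dot (d * - p.2, d * p.1) _ = d * n).
    by apply: divr_gt0 => //; exact: mulr_gt0.
  by rewrite /n /dot /perp /=; ring.
have beN x : be (opp2 x) = - be x by rewrite /be /dot /=; ring.
have Sub z : K z -> 0 < be z -> ubound S ((1 - al z) / be z).
  move=> Kz bz _ [x [Kx bx] <-].
  rewrite ler_pdivrMr ?oppr_gt0// mulrAC ler_pdivlMr//.
  by have := sepab _ _ Kx Kz bx bz; lra.
have S0 : S !=set0.
  exists ((al (opp2 u) - 1) / - be (opp2 u)); exists (opp2 u) => //.
  by split; [exact: Ksym|rewrite beN oppr_lt0].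
pose c := sup S.
exists ((p.1 - c * p.2) / n, (p.2 + c * p.1) / n).
  by rewrite -[RHS](divff nn0) {3}/n /dot /=; ring.
move=> x Kx.
rewrite (_ : dot x _ = al x + c * be x); last by rewrite /al /be /dot /perp /=; ring.
have [bx|bx|bx] := ltgtP (be x) 0.
- have : (al x - 1) / - be x <= c.
    apply: ub_le_sup; last by exists x.
    by exists ((1 - al u) / be u); exact: Sub.
  by rewrite ler_pdivrMr ?oppr_gt0//; lra.
- have : c <= (1 - al x) / be x by apply: ge_sup => //; exact: Sub.
  by rewrite ler_pdivlMr//; lra.
- rewrite bx mulr0 addr0; apply: p1.
  by move: Kx; rewrite {1}(decomp x) bx !mul0r subr0 addr0.
Qed.

Lemma Istar_closed : closed (Istar K).
Proof.
rewrite (_ : Istar K = \bigcap_(x in K) [set y | 2 * (x.2 * y.1 - x.1 * y.2) <= 1]).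
  apply: closed_bigI => x _.
  apply: (@closed_comp _ _ (fun y : R * R => 2 * (x.2 * y.1 - x.1 * y.2)) [set t | t <= 1]);
    last exact: closed_le.
  move=> y _; apply: cvgM; first exact: cvg_cst.
  apply: cvgB; apply: cvgM; [exact: cvg_cst|exact: cvg_fst|exact: cvg_cst|exact: cvg_snd].
by apply/seteqP; split=> y; [move/IstarP|move=> H; apply/IstarP].
Qed.

Lemma Istar_support_le w y : w != 0 -> Istar K y ->
  2 * rad K w * (w.2 * y.1 - w.1 * y.2) <= 1.
Proof.
move=> /radP[r0 rE] /IstarP/(_ (rad K w * w.1, rad K w * w.2)) /=.
rewrite (_ : 2 * (_ - _) = 2 * rad K w * (w.2 * y.1 - w.1 * y.2)); last by ring.
by apply; apply/rE; rewrite gtr0_norm.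
Qed.

(** A supporting line of [K] at [rad K w * w] has a normal [y0]; turned by a right angle and halved,
    it is a point of [Istar K] where the bound of [Istar_support_le] is attained. It cannot be
    interior, since a slight dilation of it would violate that bound. *)
Lemma Istar_support_max w : w != 0 -> exists2 y, bd (Istar K) y &
  2 * rad K w * (w.2 * y.1 - w.1 * y.2) = 1.
Proof.
move=> w0; have [r0 rE] := radP w0.
have [] := @body_supporting_line (rad K w * w.1, rad K w * w.2).
- apply: contra w0 => /eqP[/eqP + /eqP]; rewrite !mulf_eq0 (gt_eqF r0) /= => /eqP w1 /eqP w2.
  by rewrite (surjective_pairing w) w1 w2.
- by apply/rE; rewrite gtr0_norm.
- move=> a /=; rewrite !mulrA => /rE; rewrite normrM (gtr0_norm r0).
  by rewrite -{2}(mul1r (rad K w)) ler_pM2r//; apply: le_trans; exact: ler_norm.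
move=> y0 /= py0 Ky0.
pose y := (y0.2 / 2, - (y0.1 / 2)).
have yE : 2 * rad K w * (w.2 * y.1 - w.1 * y.2) = 1.
  by rewrite -[RHS]py0 /dot /y /=; field.
have Iy : Istar K y.
  apply/IstarP => x /Ky0; apply: le_trans; rewrite le_eqVlt; apply/orP; left; apply/eqP.
  by rewrite /dot /y /=; field.
exists y => //; split; first exact: subset_closure.
rewrite /interior -nbhs_ballE => -[e /= e0 eI].
pose m := `|y.1| + `|y.2| + 1.
have m0 : 0 < m by rewrite ltr_wpDl// addr_ge0.
pose d := e / (2 * m).
have d0 : 0 < d by rewrite divr_gt0// mulr_gt0.
have dm : d * m = e / 2 by rewrite /d; field; rewrite gt_eqF.
have : Istar K ((1 + d) * y.1, (1 + d) * y.2).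
  apply: eI; split; rewrite /ball/= /ball_ mulrDl mul1r opprD addrA subrr sub0r normrN
    normrM (gtr0_norm d0);
    (apply: (@le_lt_trans _ _ (d * m)); [rewrite ler_pM2l//|lra]).
    by rewrite /m -addrA lerDl addr_ge0.
  by rewrite /m addrAC lerDr addr_ge0.
move=> /(Istar_support_le w0) /=.
rewrite (_ : 2 * _ * _ = (1 + d) * (2 * rad K w * (w.2 * y.1 - w.1 * y.2))); last by rewrite /y /=; ring.
by rewrite yE mulr1; lra.
Qed.

End symmetric_body.

(** * Moments of a symmetric body and centroids of its halves *)

Section centroids.
Context {R : realType} (K : set (R * R)).
Hypothesis Kbody : convex_body K.
Hypothesis Ksym : origin_symmetric K.
Notation mu := (@lebesgue_measure R).
Notation mu2 := (mu \x mu)%E.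
Notation plane := (measurableTypeR R * measurableTypeR R)%type.

Definition abs_moment (v : R * R) : R := \int[mu2]_(x in K) `|dot x v|.

Lemma body_measurable : measurable (K : set plane).
Proof. exact: closed_measurable2 (body_closed Kbody). Qed.

Lemma body_area_fin : (mu2 K < +oo)%E.
Proof.
have [M M0 KM] := body_bounded Kbody.
pose B : set plane := `[(- M)%R, M]%classic `*` `[(- M)%R, M]%classic.
have mB : measurable B by apply: measurableX.
have BE : mu2 B = ((M + M) * (M + M))%:E.
  rewrite product_measure1E//.
  have E : mu `[(- M)%R, M] = (M + M)%:E.
    by rewrite lebesgue_measure_itv/= lte_fin ifT; [rewrite -EFinB opprK|lra].
  by rewrite [X in (X * X)%E]E.
apply: (@le_lt_trans _ _ (mu2 B)); last by rewrite BE ltry.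
apply: le_measure; rewrite ?inE//; first exact: body_measurable.
by move=> x /KM[x1 x2]; split; rewrite /= in_itv/= -ler_norml.
Qed.

Lemma body_area_gt0 : (0 < mu2 K)%E.
Proof.
have [e e0 eK] := body_contains_box Kbody Ksym.
pose B : set plane := `[0%R, (e / 2)%R]%classic `*` `[0%R, (e / 2)%R]%classic.
have mB : measurable B by apply: measurableX.
have BE : mu2 B = ((e / 2) * (e / 2))%:E.
  rewrite product_measure1E//.
  have E : mu `[0%R, (e / 2)%R] = (e / 2)%:E.
    by rewrite lebesgue_measure_itv/= lte_fin ifT; [rewrite -EFinB subr0|lra].
  by rewrite [X in (X * X)%E]E.
apply: (@lt_le_trans _ _ (mu2 B)).
  by rewrite BE lte_fin mulr_gt0//; lra.
apply: le_measure; rewrite ?inE//; first exact: body_measurable.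
move=> x [] /=; rewrite !in_itv/= => x1 x2.
by apply: eK; rewrite ger0_norm; lra.
Qed.

Lemma body_integrable (f : plane -> R) : measurable_fun setT f ->
  (exists C : R, forall x, K x -> `|f x| <= C) -> mu2.-integrable K (EFin \o f).
Proof.
move=> mf [C fC]; apply: measurable_bounded_integrable.
- exact: body_measurable.
- exact: body_area_fin.
- exact: measurable_funTS.
- exists C; split; first exact: num_real.
  by move=> t Ct x Kx; apply: le_trans (fC _ Kx) _; exact: ltW.
Qed.

Lemma dot_bounded v : exists C : R, forall x, K x -> `|dot x v| <= C.
Proof.
have [M M0 KM] := body_bounded Kbody.
exists (M * `|v.1| + M * `|v.2|) => x /KM[x1 x2].
apply: le_trans (ler_normD _ _) _; rewrite !normrM.
by apply: lerD; apply: ler_wpM2r.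
Qed.

Lemma dot_integrable v : mu2.-integrable K (EFin \o (fun x => dot x v)).
Proof. by apply: body_integrable; [exact: measurable_dot|exact: dot_bounded]. Qed.

Lemma abs_dot_integrable v : mu2.-integrable K (EFin \o (fun x => `|dot x v|)).
Proof.
apply: body_integrable.
  by apply: measurableT_comp; [exact: normr_measurable|exact: measurable_dot].
by have [C H] := dot_bounded v; exists C => x /H; rewrite normr_id.
Qed.

Lemma pos_dot_measurable v :
  @measurable_fun _ _ plane R setT (fun x => Num.max 0 (dot x v)).
Proof.
by apply: measurable_maxr; [exact: measurable_cst|exact: measurable_dot].
Qed.

Lemma pos_dot_integrable v : mu2.-integrable K (EFin \o (fun x => Num.max 0 (dot x v))).
Proof.
apply: body_integrable; first exact: pos_dot_measurable.
have [C H] := dot_bounded v; exists C => x /H; apply: le_trans.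
by rewrite ger0_norm ?le_max ?lexx// ge_max normr_ge0 ler_norm.
Qed.

Lemma body_opp2 : @opp2 R @^-1` K = K.
Proof.
apply/seteqP; split=> x Kx; last exact: Ksym.
by have := Ksym Kx; rewrite /opp2/= !opprK -surjective_pairing.
Qed.

Lemma dot_opp2 (x v : R * R) : dot (opp2 x) v = - dot x v.
Proof. by rewrite /dot /opp2 /=; ring. Qed.

(** The absolute value is the sum of the positive parts of [dot x v] and of its negative, and
    reflection in the origin exchanges their integrals. *)
Lemma abs_moment_pos v :
  abs_moment v = 2 * \int[mu2]_(x in K) Num.max 0 (dot x v).
Proof.
have neg_pos : \int[mu2]_(x in K) Num.max 0 (- dot x v) =
    \int[mu2]_(x in K) Num.max 0 (dot x v).
  rewrite /Rintegral; congr fine.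
  rewrite -(ge0_integral_opp2 body_measurable (pos_dot_measurable v)).
    by rewrite body_opp2; apply: eq_integral => x _; rewrite dot_opp2.
  by move=> x; rewrite le_max lexx.
have neg_int : mu2.-integrable K (EFin \o (fun x => Num.max 0 (- dot x v))).
  rewrite (_ : (fun x => _) = (fun x => Num.max 0 (dot x (opp2 v)))).
    exact: pos_dot_integrable.
  by apply/funext => x; rewrite /dot /opp2 /= !mulrN opprD.
rewrite mulr_natl mulr2n -{2}neg_pos -RintegralD.
- apply: eq_Rintegral => x _.
  have [d0|] := boolP (0 <= dot x v); last rewrite -ltNge => d0.
    have -> : Num.max 0 (dot x v) = dot x v by apply/max_idPr.
    have -> : Num.max 0 (- dot x v) = 0 by apply/max_idPl; rewrite oppr_le0.
    by rewrite ger0_norm// addr0.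
  have -> : Num.max 0 (dot x v) = 0 by apply/max_idPl; exact: ltW.
  have -> : Num.max 0 (- dot x v) = - dot x v.
    by apply/max_idPr; rewrite oppr_ge0 ltW.
  by rewrite ltr0_norm// add0r.
- exact: body_measurable.
- exact: pos_dot_integrable.
- exact: neg_int.
Qed.

Lemma centroid_dot (S : set plane) v : measurable S -> S `<=` K ->
  dot (centroid S) v = (\int[mu2]_(x in S) dot x v) / fine (area S).
Proof.
move=> mS SK.
have i1 : mu2.-integrable S (EFin \o (fun x : R * R => x.1)).
  apply: (integrableS body_measurable mS SK).
  rewrite (_ : (fun x : R * R => x.1) = (fun x => dot x (1, 0))).
    exact: dot_integrable.
  by apply/funext => x; rewrite /dot mulr1 mulr0 addr0.
have i2 : mu2.-integrable S (EFin \o (fun x : R * R => x.2)).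
  apply: (integrableS body_measurable mS SK).
  rewrite (_ : (fun x : R * R => x.2) = (fun x => dot x (0, 1))).
    exact: dot_integrable.
  by apply/funext => x; rewrite /dot mulr1 mulr0 add0r.
rewrite {1}/dot /centroid /=.
rewrite (_ : \int[mu2]_(x in S) dot x v =
  (\int[mu2]_(x in S) x.1) * v.1 + (\int[mu2]_(x in S) x.2) * v.2).
  by rewrite /Rintegral; ring.
rewrite -!RintegralZr// -RintegralD//.
- by apply: (eq_integrable mS) (integrableZr mS v.1 i1) => x _; rewrite /= EFinM.
- by apply: (eq_integrable mS) (integrableZr mS v.2 i2) => x _; rewrite /= EFinM.
Qed.

Lemma measurable_halfplane v t : measurable ([set x | dot x v <= t] : set plane).
Proof.
rewrite (_ : [set x | _] = setT `&` (fun x => dot x v) @^-1` `]-oo, t]%classic).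
  by apply: measurable_dot => //; exact: measurable_itv.
by rewrite setTI; apply/seteqP; split=> x /=; rewrite in_itv.
Qed.

(** On any subset of [K] the integral of [dot x v] is at most that of its positive part over all of
    [K], which is half of [abs_moment K v]. This half cancels against the one in [delta_star]. *)
Lemma Gamma_dot_le c v : Gamma (delta_star K) K c ->
  dot c v <= abs_moment v / fine (area K).
Proof.
move=> [xi [t [_ aS ->]]].
have mS : measurable (K `&` [set x | dot x xi <= t] : set plane).
  by apply: measurableI; [exact: body_measurable|exact: measurable_halfplane].
have SK : K `&` [set x | dot x xi <= t] `<=` K by move=> x [].
rewrite centroid_dot// aS /= /delta_star abs_moment_pos.
have A0 : 0 < fine (area K).
  by rewrite fine_gt0// body_area_gt0 body_area_fin.
rewrite invf_div mulrA ler_pM2r ?invr_gt0// mulrC ler_pM2l//.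
apply: (@le_trans _ _ (\int[mu2]_(x in K `&` [set x | dot x xi <= t]) Num.max 0 (dot x v))).
  apply: le_Rintegral => //.
  - exact: integrableS body_measurable mS SK (dot_integrable v).
  - exact: integrableS body_measurable mS SK (pos_dot_integrable v).
  - by move=> x _; rewrite le_max lexx orbT.
rewrite /Rintegral fine_le//.
- apply: integrable_fin_num => //.
  exact: integrableS body_measurable mS SK (pos_dot_integrable v).
- apply: integrable_fin_num; first exact: body_measurable.
  exact: pos_dot_integrable.
- apply: ge0_subset_integral => //.
  + exact: body_measurable.
  + by apply/measurable_EFinP; apply: measurable_funTS; exact: pos_dot_measurable.
  + by move=> x _; rewrite lee_fin le_max lexx.
Qed.

(** Reflection exchanges the two open halves, and the dividing line is null. *)
Lemma area_half v : v != 0 ->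
  area (K `&` [set x | dot x v <= 0]) = (delta_star K)%:E.
Proof.
move=> v0.
pose L := K `&` [set x | dot x v <= 0]; pose G := K `&` [set x | 0 < dot x v].
pose L' := K `&` [set x | dot x v < 0]; pose Z := K `&` [set x | dot x v = 0].
have mK := body_measurable.
have mL : measurable (L : set plane).
  by apply: measurableI => //; exact: measurable_halfplane.
have LG : L `&` G = set0.
  by apply/seteqP; split=> x // [[_ /= x0] [_ /=]]; rewrite ltNge x0.
have LGK : L `|` G = K.
  apply/seteqP; split=> [x [[]|[]]//|x Kx].
  by have [x0|x0] := leP (dot x v) 0; [left|right].
have GE : G = K `\` L.
  apply/seteqP; split=> x /= [Kx].
    by move=> x0; split=> // -[_ /=]; rewrite leNgt x0.
  by move=> xL; split=> //=; rewrite ltNge; apply/negP => x0; apply: xL.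
have mG : measurable (G : set plane) by rewrite GE; exact: measurableD.
have L'E : L' = @opp2 R @^-1` G.
  apply/seteqP; split=> x /= [Kx]; rewrite /= ?dot_opp2 => x0.
    by split; [exact: Ksym|rewrite /= dot_opp2 oppr_gt0].
  by split; [rewrite -body_opp2|rewrite /= -oppr_gt0].
have mL' : measurable (L' : set plane).
  by rewrite L'E -[X in measurable X]setTI; exact: measurable_opp2.
have mZ : measurable (Z : set plane).
  rewrite (_ : Z = L `\` L'); first exact: measurableD.
  apply/seteqP; split=> x /=.
    by move=> [Kx /= x0]; split; [split=> //=; rewrite x0|case=> _ /=; rewrite x0 ltxx].
  move=> [[Kx /= x0] xL']; split=> //=; apply/eqP; rewrite eq_le x0/= leNgt.
  by apply/negP => x1; apply: xL'.
have Z0 : mu2 Z = 0%E.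
  apply/eqP; rewrite eq_le measure_ge0 andbT -(null_line v0).
  apply: le_measure; rewrite ?inE//; last by move=> x [].
  rewrite (_ : [set x | dot x v = 0] = setT `&` (fun x => dot x v) @^-1` [set 0]).
    by apply: measurable_dot => //; exact: measurable_set1.
  by rewrite setTI.
have LZ : mu2 L = mu2 L'.
  rewrite (_ : L = L' `|` Z).
    have -> : mu2 (L' `|` Z) = (mu2 L' + mu2 Z)%E; last by rewrite Z0 adde0.
    apply: measureU => //; apply/seteqP; split=> [x [[_ /= x0] [_ /= x1]]|//].
    by move: x0; rewrite x1 ltxx.
  apply/seteqP; split=> x /=.
    by move=> [Kx /=]; rewrite le_eqVlt => /predU1P[|] x0; [right|left].
  by move=> [|] [Kx /= x0]; split=> //=; [exact: ltW|rewrite x0].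
have L'G : mu2 L' = mu2 G by rewrite L'E product_measure_opp2.
have KE : mu2 K = (mu2 L + mu2 L)%E.
  have LGE : mu2 (L `|` G) = (mu2 L + mu2 G)%E by apply: measureU.
  by rewrite -[in LHS]LGK LGE -L'G -LZ.
have Lfin : mu2 L \is a fin_num.
  rewrite ge0_fin_numE ?measure_ge0//; apply: le_lt_trans body_area_fin.
  by apply: le_measure; rewrite ?inE//; move=> x [].
rewrite /area -/L /delta_star /area KE fineD// -[LHS]fineK//; congr EFin.
by move: (fine _) => z; lra.
Qed.

Lemma Gamma_dot_max v : v != 0 -> exists2 c, Gamma (delta_star K) K c &
  dot c v = abs_moment v / fine (area K).
Proof.
move=> v0.
have n20 := dot_self_gt0 v0.
pose n := Num.sqrt (dot v v).
have n0 : 0 < n by rewrite sqrtr_gt0.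
have nn : n * n = dot v v by rewrite -expr2 sqr_sqrtr// ltW.
(* [Gamma] cuts off the side where [dot x xi] is small, so the half with [dot x v >= 0] belongs to
   the direction opposite to [v]. *)
pose xi := (- v.1 / n, - v.2 / n).
have uxi : unitv xi.
  rewrite /unitv /xi (_ : dot _ _ = dot v v / (n * n)).
    by rewrite nn divff// gt_eqF.
  by rewrite /dot /=; field; rewrite gt_eqF.
have xiE : [set x : R * R | dot x xi <= 0] = [set x | dot x (opp2 v) <= 0].
  apply/seteqP; split=> x /=; rewrite (_ : dot x xi = dot x (opp2 v) / n).
  - by rewrite pmulr_lle0 ?invr_gt0.
  - by rewrite /dot /=; field; rewrite gt_eqF.
  - by rewrite pmulr_lle0 ?invr_gt0.
  - by rewrite /dot /=; field; rewrite gt_eqF.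
have ov0 : opp2 v != 0.
  apply: contra v0 => /eqP[/eqP + /eqP]; rewrite !oppr_eq0 => /eqP v1 /eqP v2.
  by rewrite (surjective_pairing v) v1 v2.
have aS := area_half ov0.
set S := K `&` [set x | dot x (opp2 v) <= 0] in aS *.
have mS : measurable (S : set plane).
  by apply: measurableI; [exact: body_measurable|exact: measurable_halfplane].
have SK : S `<=` K by move=> x [].
exists (centroid S).
  by exists xi, 0; split; [exact: uxi|rewrite xiE|rewrite xiE].
rewrite centroid_dot// aS /= /delta_star abs_moment_pos.
have A0 : 0 < fine (area K).
  by rewrite fine_gt0// body_area_gt0 body_area_fin.
rewrite invf_div mulrA; congr (_ / _); rewrite mulrC; congr (_ * _).
rewrite Rintegral_mkcondr; apply: eq_Rintegral => x; rewrite inE => Kx.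
rewrite patchE; case: ifPn => [|/negP].
  rewrite inE/= => x0; rewrite (max_idPr _)//.
  by move: x0; rewrite /dot /opp2 /=; lra.
rewrite inE/= => x0; rewrite (max_idPl _)// leNgt; apply/negP => x1.
by apply: x0; move: x1; rewrite /dot /opp2 /=; lra.
Qed.

End centroids.

(** * Homothety as a relation between moment and radius *)

Section homothetic_curves.
Context {R : realType} (K : set (R * R)).
Hypothesis Kbody : convex_body K.
Hypothesis Ksym : origin_symmetric K.
Notation mu := (@lebesgue_measure R).
Notation mu2 := (mu \x mu)%E.
Notation plane := (measurableTypeR R * measurableTypeR R)%type.

Lemma slope_neq0 (m : R) : ((1, m) : R * R) != 0.
Proof. by apply/eqP => -[/eqP]; rewrite oner_eq0. Qed.

Lemma body_slopeP (x1 x2 : R) : x1 != 0 ->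
  K (x1, x2) <-> `|x1| <= rad K (1, x2 / x1).
Proof.
move=> x10; have [_ rE] := radP Kbody Ksym (slope_neq0 (x2 / x1)).
by rewrite -rE /= mulr1 mulrCA divff// mulr1.
Qed.

(* Both curves are compared through their support functions; averaging over
   [v] and [- v] removes the centre of the homothety. *)
Lemma homothetic_abs_moment : homothetic (Gamma (delta_star K) K) (bd (Istar K)) ->
  exists2 B : R, 0 < B & forall w, w != 0 -> abs_moment K (w.2, - w.1) * rad K w = B.
Proof.
move=> [q [lam [lam0 GE]]].
have A0 : 0 < fine (area K).
  by rewrite fine_gt0// body_area_gt0// body_area_fin.
exists (lam * fine (area K) / 2); first by rewrite divr_gt0// mulr_gt0.
have bdI y : bd (Istar K) y -> Istar K y.
  by move=> [/(Istar_closed Kbody Ksym)].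
(* Both sides are the maximum of [dot c (w.2, - w.1)] over the same curve, computed once as [Gamma]
   and once as the homothetic image of [bd (Istar K)]. *)
have key w : w != 0 -> abs_moment K (w.2, - w.1) / fine (area K) =
    (1 - lam) * dot q (w.2, - w.1) + lam / (2 * rad K w).
  move=> w0; have [r0 _] := radP Kbody Ksym w0.
  have v0 : ((w.2, - w.1) : R * R) != 0.
    apply: contra w0 => /eqP[/eqP + /eqP]; rewrite oppr_eq0 => /eqP w2 /eqP w1.
    by rewrite (surjective_pairing w) w1 w2.
  have r20 : 0 < 2 * rad K w by rewrite mulr_gt0.
  apply/eqP; rewrite eq_le; apply/andP; split.
  - have [c Gc <-] := Gamma_dot_max Kbody Ksym v0.
    move: Gc; rewrite GE => -[y /bdI Iy <-].
    have := Istar_support_le Kbody Ksym w0 Iy.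
    rewrite mulrC -ler_pdivlMr// mul1r -(ler_pM2l lam0) => H.
    apply: (@le_trans _ _ ((1 - lam) * dot q (w.2, - w.1) +
      lam * (w.2 * y.1 - w.1 * y.2))); last by rewrite lerD2l.
    by rewrite le_eqVlt; apply/orP; left; apply/eqP; rewrite /dot /=; ring.
  - have [y bdy yE] := Istar_support_max Kbody Ksym w0.
    have Gc : Gamma (delta_star K) K (q.1 + lam * (y.1 - q.1), q.2 + lam * (y.2 - q.2)).
      by rewrite GE; exists y.
    apply: le_trans (Gamma_dot_le Kbody Ksym (w.2, - w.1) Gc).
    rewrite le_eqVlt; apply/orP; left; apply/eqP.
    rewrite (_ : lam / _ = lam * (w.2 * y.1 - w.1 * y.2)); first by rewrite /dot /=; ring.
    congr (_ * _); apply: (mulfI (lt0r_neq0 r20)).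
    by rewrite mulfV ?lt0r_neq0.
move=> w w0; have [r0 _] := radP Kbody Ksym w0.
have ow0 : opp2 w != 0.
  apply: contra w0 => /eqP[/eqP + /eqP]; rewrite !oppr_eq0 => /eqP w1 /eqP w2.
  by rewrite (surjective_pairing w) w1 w2.
have k1 := key _ w0; have := key _ ow0.
rewrite (rad_opp Ksym).
have -> : abs_moment K ((opp2 w).2, - (opp2 w).1) = abs_moment K (w.2, - w.1).
  apply: eq_Rintegral => x _; rewrite -normrN; congr `|_|.
  by rewrite /dot /opp2 /=; ring.
have -> : dot q ((opp2 w).2, - (opp2 w).1) = - dot q (w.2, - w.1).
  by rewrite /dot /opp2 /=; ring.
move=> k2.
have {k1 k2} : abs_moment K (w.2, - w.1) / fine (area K) = lam / (2 * rad K w) by lra.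
move=> /(congr1 (fun z => z * fine (area K) * rad K w)).
by rewrite divfK ?gt_eqF// => ->; field; rewrite gt_eqF.
Qed.

(** * Second differences of the moment as a function of the slope *)

Lemma wedge_height_ge0 (s h : R) x : 0 <= wedge_height s h x.
Proof. by rewrite le_max lexx. Qed.

Lemma wedge_height_integrable (s h : R) : 0 <= h ->
  mu2.-integrable K (EFin \o wedge_height s h).
Proof.
move=> h0; apply: (@body_integrable _ _ Kbody (wedge_height s h)).
  exact: measurable_wedge_height.
have [M M0 KM] := body_bounded Kbody.
exists (h * M) => x /KM[x1 _]; rewrite ger0_norm ?wedge_height_ge0//.
rewrite ge_max; apply/andP; split.
  by rewrite mulr_ge0// ltW.
apply: (@le_trans _ _ (h * `|x.1|)); last by rewrite ler_wpM2l.
by rewrite gerBl.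
Qed.

(** Pointwise this is [|a + b| + |a - b| - 2 |a| = 2 max(0, |b| - |a|)] with [a = s * x.1 - x.2] and
    [b = h * x.1]. *)
Lemma abs_moment_second_difference (s h : R) : 0 < h ->
  abs_moment K (s + h, -1) + abs_moment K (s - h, -1) - 2 * abs_moment K (s, -1) =
  2 * \int[mu2]_(x in K) wedge_height s h x.
Proof.
move=> h0; have mK := body_measurable Kbody.
have i v := abs_dot_integrable Kbody v.
have i2 v : mu2.-integrable K (EFin \o (fun x => 2 * `|dot x v|)).
  by apply: (eq_integrable mK) (integrableZl mK 2 (i v)) => x _; rewrite /= EFinM.
have i3 v w : mu2.-integrable K (EFin \o (fun x => `|dot x v| + `|dot x w|)).
  by apply: (eq_integrable mK) (integrableD mK (i v) (i w)) => x _; rewrite /= EFinD.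
rewrite -!RintegralZl//; last exact/wedge_height_integrable/ltW.
rewrite -RintegralD// -RintegralB//.
apply: eq_Rintegral => x _; rewrite /dot /wedge_height /=.
set a := s * x.1 - x.2.
rewrite (_ : x.1 * (s + h) + x.2 * -1 = a + h * x.1); last by rewrite /a; ring.
rewrite (_ : x.1 * (s - h) + x.2 * -1 = a - h * x.1); last by rewrite /a; ring.
rewrite (_ : x.1 * s + x.2 * -1 = a); last by rewrite /a; ring.
rewrite (_ : h * `|x.1| = `|h * x.1|); last by rewrite normrM gtr0_norm.
move: (h * x.1) => b.
have [ba|ba] := leP `|b| `|a|.
  rewrite (_ : Num.max _ _ = 0); last by apply/max_idPl; rewrite subr_le0.
  move: ba; have [b0|b0] := leP 0 b; have [a0|a0] := leP 0 a;
    rewrite ?(ger0_norm a0) ?(ltr0_norm a0) ?(ger0_norm b0) ?(ltr0_norm b0) => ba;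
    [rewrite !ger0_norm|rewrite !ler0_norm|rewrite !ger0_norm|rewrite !ler0_norm]; lra.
rewrite (_ : Num.max _ _ = `|b| - `|a|); last by apply/max_idPr; rewrite subr_ge0 ltW.
move: ba; have [b0|b0] := leP 0 b; have [a0|a0] := leP 0 a;
  rewrite ?(ger0_norm a0) ?(ltr0_norm a0) ?(ger0_norm b0) ?(ltr0_norm b0) => ba.
- by rewrite (@ger0_norm _ (a + b)) 1?(@ler0_norm _ (a - b)); lra.
- by rewrite (@ger0_norm _ (a + b)) 1?(@ler0_norm _ (a - b)); lra.
- by rewrite (@ler0_norm _ (a + b)) 1?(@ger0_norm _ (a - b)); lra.
- by rewrite (@ler0_norm _ (a + b)) 1?(@ger0_norm _ (a - b)); lra.
Qed.

Lemma wedge_height_gt0 (s h : R) x : 0 < wedge_height s h x ->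
  x.1 != 0 /\ `|x.2 / x.1 - s| < h.
Proof.
rewrite lt_max ltxx/= subr_gt0 => sx.
have x10 : x.1 != 0.
  by apply: contraTneq sx => ->; rewrite normr0 !mulr0 -leNgt normr_ge0.
split=> //; rewrite -(ltr_pM2r (_ : 0 < `|x.1|)) ?normr_gt0//.
by rewrite -normrM mulrBl divfK// distrC.
Qed.

(** Inclusion is required only on the support of the integrand; this allows [K] to be compared with
    strips that neither contain it nor lie in it. *)
Lemma le_integral_wedge_height (s h : R) (A B : set plane) :
  measurable A -> measurable B ->
  (forall x, A x -> 0 < wedge_height s h x -> B x) ->
  (\int[mu2]_(x in A) (wedge_height s h x)%:E <=
   \int[mu2]_(x in B) (wedge_height s h x)%:E)%E.
Proof.
move=> mA mB AB; rewrite integral_mkcond [leRHS]integral_mkcond.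
have mgE : @measurable_fun _ _ plane _ setT (EFin \o wedge_height s h).
  by apply/measurable_EFinP; exact: measurable_wedge_height.
have mr (C : set plane) : measurable C ->
    @measurable_fun _ _ plane _ setT ((EFin \o wedge_height s h) \_ C).
  by move=> mC; apply/(measurable_restrictT _ mC); exact: measurable_funTS.
apply: ge0_le_integral => //.
- by move=> x _; rewrite patchE; case: ifP => // _; rewrite lee_fin wedge_height_ge0.
- exact: mr.
- exact: mr.
- move=> x _; rewrite !patchE; case: ifPn => [|_]; last first.
    by case: ifP => // _; rewrite lee_fin wedge_height_ge0.
  rewrite inE => Ax; have := wedge_height_ge0 s h x; rewrite le_eqVlt => /predU1P[<-|gx].
    by case: ifP.
  by rewrite mem_set//; exact: AB gx.
Qed.

(** Within the wedge, [K] contains the strip [|x.1| <= b] and lies in the strip [|x.1| <= a]; twice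
    the strip integral gives the factor [4 / 3]. *)
Lemma abs_moment_second_difference_bounds (s h a b : R) : 0 < h -> 0 <= b ->
  (forall m, `|m - s| < h -> b <= rad K (1, m) <= a) ->
  4 / 3 * b ^+ 3 * h ^+ 2 <=
  abs_moment K (s + h, -1) + abs_moment K (s - h, -1) - 2 * abs_moment K (s, -1) <=
  4 / 3 * a ^+ 3 * h ^+ 2.
Proof.
move=> h0 b0 H; rewrite abs_moment_second_difference//.
have a0 : 0 <= a.
  by have := H s; rewrite subrr normr0 => /(_ h0)/andP[? ?]; lra.
have mK := body_measurable Kbody.
have Kfin : (\int[mu2]_(x in K) (wedge_height s h x)%:E \is a fin_num)%E.
  by apply: integrable_fin_num => //; exact/wedge_height_integrable/ltW.
have lo : ((2 / 3 * b ^+ 3 * h ^+ 2)%:E <= \int[mu2]_(x in K) (wedge_height s h x)%:E)%E.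
  rewrite -(integral_wedge_height s (ltW h0) b0).
  apply: le_integral_wedge_height => //; first exact: measurable_strip.
  move=> [x1 x2] /= xb.
  move=> /wedge_height_gt0/= [x10 /H/andP[bm _]]; apply/body_slopeP => //.
  exact: le_trans xb bm.
have up : (\int[mu2]_(x in K) (wedge_height s h x)%:E <= (2 / 3 * a ^+ 3 * h ^+ 2)%:E)%E.
  rewrite -(integral_wedge_height s (ltW h0) a0).
  apply: le_integral_wedge_height => //; first exact: measurable_strip.
  move=> [x1 x2] /= Kx.
  move=> /wedge_height_gt0/= [x10 /H/andP[_ ma]]; apply: le_trans ma.
  by apply/body_slopeP.
move: lo up; rewrite -(fineK Kfin) !lee_fin -/(Rintegral mu2 K (wedge_height s h)).
move: (Rintegral _ _ _) => z lo up.
by apply/andP; split; lra.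
Qed.

Lemma abs_moment_lipschitz : exists2 C : R, 0 < C &
  forall s t, abs_moment K (s, -1) <= abs_moment K (t, -1) + C * `|s - t|.
Proof.
have mK := body_measurable Kbody.
have i v := abs_dot_integrable Kbody v.
have i1 := i (1, 0).
have c0 : 0 <= abs_moment K (1, 0) by apply: Rintegral_ge0 => x _.
exists (abs_moment K (1, 0) + 1); first by lra.
move=> s t; apply: (@le_trans _ _ (abs_moment K (t, -1) + `|s - t| * abs_moment K (1, 0))).
  have i2 : mu2.-integrable K (EFin \o (fun x => `|s - t| * `|dot x (1, 0)|)).
    by apply: (eq_integrable mK) (integrableZl mK `|s - t| i1) => x _; rewrite /= EFinM.
  rewrite -RintegralZl// -RintegralD//; apply: le_Rintegral => //.
    by apply: (eq_integrable mK) (integrableD mK (i (t, -1)) i2) => x _; rewrite /= EFinD.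
  move=> x _; rewrite -normrM.
  rewrite (_ : dot x (s, -1) = dot x (t, -1) + (s - t) * dot x (1, 0)).
    exact: ler_normD.
  by rewrite /dot /=; ring.
by rewrite lerD2l mulrC ler_wpM2r//; lra.
Qed.

Lemma abs_moment_continuous : continuous (fun s => abs_moment K (s, -1)).
Proof.
have [C C0 H] := abs_moment_lipschitz.
move=> s; apply/cvgrPdist_lt => e e0.
exists (e / C) => /=; first by rewrite divr_gt0.
move=> t /=; rewrite ltr_pdivlMr// mulrC => st.
apply: le_lt_trans st; rewrite ler_norml; apply/andP; split.
  by have := H t s; rewrite distrC; lra.
by have := H s t; lra.
Qed.

Lemma abs_moment_sym_derive2 (s : R) :
  {for s, continuous (fun m => rad K (1, m))} ->
  sym_derive2 (fun m => abs_moment K (m, -1)) s (4 / 3 * rad K (1, s) ^+ 3).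
Proof.
move=> cr e e0; set r := rad K (1, s).
have [r0 _] := radP Kbody Ksym (slope_neq0 s).
have cube : {for r, continuous (fun t : R => 4 / 3 * t ^+ 3)}.
  apply: cvgM; first exact: cvg_cst.
  by apply: cvgM; [exact: cvg_id|apply: cvgM; exact: cvg_id].
have /cvgrPdist_le/(_ _ e0)[d1 /= d10 D1] := cube.
(* Halving [d1] keeps [r + eta] and [r - eta] strictly within [d1] of [r]; the cap by [r] keeps the
   lower radius [r - eta] nonnegative. *)
pose eta := Num.min (d1 / 2) r.
have eta0 : 0 < eta by rewrite lt_min r0 divr_gt0.
have [etad etar] : eta <= d1 / 2 /\ eta <= r by rewrite /eta !ge_min !lexx ?orbT.
have /cvgrPdist_le/(_ _ eta0)[d2 /= d20 D2] := cr.
exists d2 => // h h0 hd.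
have /= := @abs_moment_second_difference_bounds s h (r + eta) (r - eta) h0.
move=> /(_ ltac:(lra))/(_ _)/andP[].
  move=> m ms; have : `|r - rad K (1, m)| <= eta.
    by apply: D2 => /=; rewrite distrC; apply: lt_trans hd.
  by rewrite ler_norml => /andP[? ?]; apply/andP; split; lra.
have := D1 (r + eta); have := D1 (r - eta).
rewrite /= opprB addrA addrAC subrr add0r opprD addrA subrr sub0r normrN (gtr0_norm eta0).
move=> /(_ ltac:(lra)); rewrite ler_norml => /andP[l1 l2].
move=> /(_ ltac:(lra)); rewrite ler_norml => /andP[u1 u2] lo up.
have h20 : 0 <= h ^+ 2 by rewrite sqr_ge0.
have := ler_wpM2r h20 l2; have := ler_wpM2r h20 u1.
by move=> ? ?; rewrite ler_norml; apply/andP; split; lra.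
Qed.

(** * The quadratic form and the ellipse *)

Lemma body_quadratic : homothetic (Gamma (delta_star K) K) (bd (Istar K)) ->
  exists al be ga : R, forall m, (rad K (1, m))^-1 ^+ 2 = al * m ^+ 2 + be * m + ga.
Proof.
move=> /homothetic_abs_moment[B B0 BE].
pose M s := abs_moment K (s, -1).
have r0 m : 0 < rad K (1, m) by have [] := radP Kbody Ksym (slope_neq0 m).
have MB m : M m * rad K (1, m) = B by exact: BE (slope_neq0 m).
have ME m : M m = B / rad K (1, m) by rewrite -(MB m) mulfK// gt_eqF.
have M0 m : 0 < M m by rewrite ME divr_gt0.
have rE m : rad K (1, m) = B / M m by rewrite -(MB m) mulrC mulKf// gt_eqF.
(* The radius inherits its continuity from [M] through [M m * rad K (1, m) = B]. *)
have cr : continuous (fun m => rad K (1, m)).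
  rewrite (_ : (fun m => _) = (fun m => B / M m)); last by apply/funext.
  move=> m; apply: cvgM; first exact: cvg_cst.
  by apply: cvgV; [rewrite gt_eqF|exact: abs_moment_continuous].
have [p [q [r MQ]]] : exists p q r, forall s, M s ^+ 2 = p * s ^+ 2 + q * s + r.
  apply: (@ermakov_square_quadratic _ M (4 / 3 * B ^+ 3)) => //.
    exact: abs_moment_continuous.
  move=> s; have -> : 4 / 3 * B ^+ 3 / M s ^+ 3 = 4 / 3 * rad K (1, s) ^+ 3; last first.
    exact: (abs_moment_sym_derive2 (cr s)).
  by rewrite rE; field; rewrite gt_eqF.
exists (p / B ^+ 2), (q / B ^+ 2), (r / B ^+ 2) => m.
have -> : (rad K (1, m))^-1 = M m / B by rewrite rE invf_div.
by rewrite expr_div_n MQ; field; rewrite gt_eqF.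
Qed.

(** Boundedness of [K] makes [Q] positive definite. Slopes describe only the points with [x.1 != 0];
    membership on the vertical axis is recovered from convexity and closedness. *)
Lemma quadratic_is_ellipse (al be ga : R) :
  (forall m, (rad K (1, m))^-1 ^+ 2 = al * m ^+ 2 + be * m + ga) -> is_ellipse K.
Proof.
move=> QE; pose Q (x : R * R) := al * x.2 ^+ 2 + be * x.1 * x.2 + ga * x.1 ^+ 2.
have r0 m : 0 < rad K (1, m) by have [] := radP Kbody Ksym (slope_neq0 m).
have KQ x : x.1 != 0 -> K x <-> Q x <= 1.
  case: x => x1 x2 /= x10; rewrite body_slopeP//.
  have -> : Q (x1, x2) = (`|x1| / rad K (1, x2 / x1)) ^+ 2.
    by rewrite exprMn QE real_normK ?num_real// /Q /=; field.
  rewrite -[X in _ <-> _ <= X](expr1n _ 2) ler_sqr ?nnegrE//; last first.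
    by rewrite divr_ge0// ltW.
  by rewrite ler_pdivrMr// mul1r.
have [C C0 KC] := body_bounded Kbody.
have [e e0 eK] := body_contains_box Kbody Ksym.
(* Both coordinates of the boundary point [rad K (1, m) * (1, m)] are at most [C] in absolute value;
   the two squared bounds are added. *)
have lower m : (1 + m ^+ 2) <= 2 * C ^+ 2 * (al * m ^+ 2 + be * m + ga).
  rewrite -QE; have [_ rE] := radP Kbody Ksym (slope_neq0 m).
  have /KC/= [] : K (rad K (1, m) * 1, rad K (1, m) * m).
    by apply/rE; rewrite gtr0_norm.
  rewrite mulr1 normrM (gtr0_norm (r0 m)) => H1 H2.
  have i0 : 0 < (rad K (1, m))^-1 by rewrite invr_gt0.
  have {}H1 : 1 <= C * (rad K (1, m))^-1 by rewrite ler_pdivlMr// mul1r.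
  have {}H2 : `|m| <= C * (rad K (1, m))^-1 by rewrite ler_pdivlMr// mulrC.
  have := ler_pM (normr_ge0 m) (normr_ge0 m) H2 H2.
  rewrite -expr2 real_normK ?num_real// => H3.
  have := ler_pM ler01 ler01 H1 H1; rewrite mul1r => H4.
  by rewrite expr2; lra.
have al0 : 0 < al.
  rewrite ltNge; apply/negP => al0.
  have c0 : 0 < 2 * C ^+ 2 by rewrite mulr_gt0// exprn_gt0.
  pose k := 2 * C ^+ 2.
  (* If [al <= 0], the right side of [lower] grows at most linearly for positive slopes; at this [m]
     the square [m ^ 2] already exceeds it. *)
  pose m := k * `|be| + k * `|ga| + 1.
  have kb : 0 <= k * `|be| by rewrite mulr_ge0// ltW.
  have kg : 0 <= k * `|ga| by rewrite mulr_ge0// ltW.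
  have m1 : 1 <= m by rewrite /m; lra.
  have L : 1 + m ^+ 2 <= k * (al * m ^+ 2) + k * (be * m) + k * ga.
    by rewrite -!mulrDr; exact: lower.
  have L1 : k * (al * m ^+ 2) <= 0.
    by rewrite pmulr_rle0// mulr_le0_ge0// sqr_ge0.
  have L2 : k * (be * m) <= k * `|be| * m.
    by rewrite mulrA ler_wpM2r ?ler_pM2l ?ler_norm//; lra.
  have L3 : k * ga <= k * `|ga| * m.
    apply: (@le_trans _ _ (k * `|ga|)); first by rewrite ler_pM2l ?ler_norm.
    by rewrite ler_peMr.
  have L4 : m ^+ 2 = k * `|be| * m + k * `|ga| * m + m by rewrite /m; ring.
  have : 1 + m ^+ 2 <= 0 + k * `|be| * m + k * `|ga| * m.
    by apply: le_trans L _; apply: lerD => //; exact: lerD.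
  by rewrite L4; move: (_ * m) (_ * m) => y z; lra.
pose D := ga - be ^+ 2 / (4 * al).
have D0 : 0 < D.
  (* The quadratic in the slope attains its minimum [D] here. *)
  have := lower (- be / (2 * al)).
  rewrite (_ : al * _ + _ + ga = D); last by rewrite /D; field; rewrite gt_eqF.
  move=> H; rewrite -(pmulr_rgt0 _ (_ : 0 < 2 * C ^+ 2)); last first.
    by rewrite mulr_gt0// exprn_gt0.
  by apply: lt_le_trans H; rewrite ltr_pwDl// sqr_ge0.
have QD x : Q x = al * (x.2 + be / (2 * al) * x.1) ^+ 2 + D * x.1 ^+ 2.
  by rewrite /Q /D; field; rewrite gt_eqF.
pose k := be / (2 * al).
have QD' u y : Q (u, y - k * u) = al * y ^+ 2 + D * u ^+ 2.
  by rewrite QD /= -/k subrK.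
have [_ [Kconv _]] := Kbody.
have KQ0 x2 : K (0, x2) <-> Q (0, x2) <= 1.
  have -> : Q (0, x2) = al * x2 ^+ 2.
    by rewrite /Q /= mulr0 mul0r expr0n /= mulr0 !addr0.
  split=> [K2|z1].
    rewrite leNgt; apply/negP; set z := al * x2 ^+ 2 => z1.
    (* Mixing [(0, x2)] with a point [(c, - k * c)], on which the [al] term of [QD] vanishes, leaves
       the vertical axis. At the mixture [Q] is at least [t ^ 2 * z = (z + 1) ^ 2 / (4 * z)], which
       exceeds 1 when [z > 1]. *)
    pose t := (z + 1) / (2 * z).
    have z20 : 0 < 2 * z by lra.
    have t0 : 0 <= t by rewrite divr_ge0//; lra.
    have t1 : 0 < 1 - t by rewrite subr_gt0 ltr_pdivrMr//; lra.
    have k1 : 0 < 1 + `|k| by rewrite ltr_pwDl.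
    pose c := e / 2 / (1 + `|k|).
    have c0 : 0 < c by rewrite !divr_gt0.
    have cE : c * (1 + `|k|) = e / 2 by rewrite divfK// gt_eqF.
    have ck : 0 <= c * `|k| by rewrite mulr_ge0// ltW.
    have Kc : K (c, - k * c).
      apply: eK => /=; first by rewrite (gtr0_norm c0); lra.
      by rewrite normrM normrN (gtr0_norm c0); lra.
    have := Kconv _ _ t K2 Kc; rewrite t0 /= => /(_ ltac:(lra)).
    rewrite mulr0 add0r => Kx.
    have := (KQ _ _).1 Kx; rewrite /= mulf_eq0 !gt_eqF//= => /(_ isT).
    rewrite (_ : t * x2 + (1 - t) * (- k * c) = t * x2 - k * ((1 - t) * c)); last by ring.
    rewrite QD' => Q1.
    have Du : 0 <= D * ((1 - t) * c) ^+ 2 by rewrite mulr_ge0 ?sqr_ge0// ltW.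
    have tz : al * (t * x2) ^+ 2 = (z + 1) ^+ 2 / (4 * z).
      rewrite exprMn mulrCA -/z /t; field; lra.
    have : 1 < (z + 1) ^+ 2 / (4 * z).
      rewrite ltr_pdivlMr; last by lra.
      have : 0 < (z - 1) ^+ 2 by rewrite exprn_gt0// subr_gt0.
      by clearbody z; nra.
    lra.
  (* [(0, y)] is the midpoint of [(u, y - k * u)] and [(- u, y + k * u)], where [u] is chosen so
     that [Q] equals 1 at both. *)
  have inside y : al * y ^+ 2 < 1 -> K (0, y).
    move=> y1; pose d := 1 - al * y ^+ 2.
    have d0 : 0 < d by rewrite subr_gt0.
    pose u := Num.sqrt (d / D).
    have u0 : 0 < u by rewrite sqrtr_gt0 divr_gt0.
    have uE : D * u ^+ 2 = d.
      by rewrite sqr_sqrtr ?divr_ge0 ?ltW// mulrC divfK// gt_eqF.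
    have K1 : K (u, y - k * u).
      by apply/KQ; rewrite ?gt_eqF// QD' uE /d; lra.
    have K2 : K (- u, y - k * - u).
      by apply/KQ; rewrite /= ?oppr_eq0 ?gt_eqF// QD' sqrrN uE /d; lra.
    have := Kconv _ _ 2^-1 K1 K2 ltac:(lra).
    rewrite /= (_ : _ * u + _ = 0); last by field.
    by rewrite (_ : 2^-1 * (y - k * u) + _ = y)//; field.
  have [->|x20] := eqVneq x2 0.
    by apply: eK; rewrite normr0.
  have w0 : ((0, x2) : R * R) != 0.
    by apply: contra x20 => /eqP[->].
  have [rr rE] := radP Kbody Ksym w0.
  have : K (1 * 0, 1 * x2).
    apply/(rE 1); rewrite normr1 leNgt; apply/negP => r1.
    (* If the radius were below 1, the multiple of [(0, x2)] by this [t], strictly between the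
       radius and 1, would lie in [K] by [inside]. *)
    pose t := (1 + rad K (0, x2)) / 2.
    have t0 : 0 < t by rewrite /t; lra.
    have : K (t * 0, t * x2).
      rewrite mulr0; apply: inside; rewrite exprMn mulrCA.
      have z0 : 0 < al * x2 ^+ 2 by rewrite mulr_gt0// exprn_even_gt0.
      have : t ^+ 2 < 1 by rewrite expr_lt1// /t; lra.
      by move=> ?; nra.
    by move=> /(rE t); rewrite gtr0_norm// /t; lra.
  by rewrite mulr0 mul1r.
pose sD := Num.sqrt D; pose sA := Num.sqrt al.
have sD0 : 0 < sD by rewrite sqrtr_gt0.
have sA0 : 0 < sA by rewrite sqrtr_gt0.
have sDE : sD ^+ 2 = D by rewrite sqr_sqrtr// ltW.
have sAE : sA ^+ 2 = al by rewrite sqr_sqrtr// ltW.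
(* The inverse of the map to [(sD * x.1, sA * (x.2 + k * x.1))], in which [Q] becomes a sum of two
   squares. *)
exists (0, 0), sD^-1, 0, (- (be / (2 * al)) / sD), sA^-1; split.
  by rewrite mul0r subr0 mulf_neq0// invr_eq0 gt_eqF.
have KQx x : K x <-> Q x <= 1.
  have [x10|/KQ//] := eqVneq x.1 0.
  by rewrite (surjective_pairing x) x10.
apply/seteqP; split=> [x /KQx|_ [z /= z1 <-]].
  rewrite QD => Qx.
  exists (sD * x.1, sA * (x.2 + be / (2 * al) * x.1)) => /=.
    by rewrite !exprMn sDE sAE addrC.
  rewrite [RHS]surjective_pairing; congr pair; field; rewrite ?gt_eqF//.
apply/KQx; rewrite QD /=; apply: le_trans z1.
rewrite -sDE -sAE le_eqVlt; apply/orP; left; apply/eqP.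
by field; rewrite !gt_eqF.
Qed.

End homothetic_curves.

Theorem theorem4p11 (R : realType) (K : set (R * R)) :
  convex_body K -> origin_symmetric K -> C2_boundary K ->
  homothetic (Gamma (delta_star K) K) (bd (Istar K)) ->
  is_ellipse K.
Proof.
move=> Kbody Ksym _ /(body_quadratic Kbody Ksym)[al [be [ga QE]]].
exact: quadratic_is_ellipse QE.
Qed.
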